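(* Let $P$ be a Delzant polytope in $(\mathbb{R}^m)^*$ with $d$ facets obtained by cutting the standard simplex by means of hyperplanes parallel to the facets of the simplex, and let $Z$ and $\widehat N=Sp(1)^{d-m}$ be associated with $P$. Then a group $\widehat G$ isomorphic to $Sp(1)^m$ and acting on $Z/\widehat N$ can be defined in such a way that its action on $Z/\widehat N$ is effective and has trivial principal isotropy.
   Context: $Sp(1)$ is the group of unit quaternions. The standard simplex in $(\mathbb{R}^m)^*$ has primitive outward-pointing facet normals $-e_1,\ldots,-e_m,\,e_1+\cdots+e_m$. Let $P=\{x\in(\mathbb{R}^m)^*: \langle x,v_i\rangle\le\lambda_i,\ i=1,\ldots,d\}$ be a Delzant polytope (a convex polytope with $m$ edges at each vertex, the edges at each vertex being directed by a $\mathbb{Z}$-basis of $\mathbb{Z}^m$) with $d$ facets and primitive outward-pointing normals $v_i\in\mathbb{Z}^m$. The map $\pi:\mathbb{R}^d\to\mathbb{R}^m$, $e_i\mapsto v_i$, induces a surjection of tori $T^d\to T^m$ with kernel $N\cong(S^1)^{d-m}$ and Lie algebra $\mathfrak{n}=\ker\pi\subset\mathbb{R}^d$, with inclusion $i:\mathfrak{n}\to\mathbb{R}^d$. $N$ acts on $\mathbb{H}^d$ as a subgroup of $T^d\subset Sp(1)^d$ by coordinatewise multiplication. Standing assumption: this action extends to $\widehat N=Sp(1)^{d-m}$, i.e. there is an action of $Sp(1)^{d-m}$ of the form $(h_1,\ldots,h_{d-m})(q_1,\ldots,q_d)=(h_{k_1}^{\alpha_1}q_1h_{j_1}^{\beta_1},\ldots,h_{k_d}^{\alpha_d}q_dh_{j_d}^{\beta_d})$,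 $\alpha_\ell\in\{0,1\}$, $\beta_\ell\in\{0,-1\}$, which for some identification $N\cong(S^1)^{d-m}$ restricts on $\mathbb{C}^d\subset\mathbb{H}^d$ to the action of $N$. Let $\sigma(q_1,\ldots,q_d)=-\frac14(|q_1|^4,\ldots,|q_d|^4)+(\lambda_1,\ldots,\lambda_d)$ and $Z=(i^*\circ\sigma)^{-1}(0)\subset\mathbb{H}^d$, where $i^*:(\mathbb{R}^d)^*\to\mathfrak{n}^*$ is dual to the inclusion. $\widehat N$ acts freely on $Z$, and $Z/\widehat N$ is a compact manifold of dimension $4m$. The group $\widehat G\cong Sp(1)^m$ is to act on $Z/\widehat N$ via multiplication on coordinates of $\mathbb{H}^d$ taking $\widehat N$-orbits to $\widehat N$-orbits.
   Formalization: The extension of N to Sp(1)^(d-m) is not unique and the claim fails for some extensions (e.g. one for a trapezoid); here a suitable extension is shown to exist together with the group Sp(1)^m, instead of being given in advance. *)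

(* Defs.v *)
From HB Require Import structures.
From mathcomp Require Import all_boot all_order all_algebra all_fingroup.
From mathcomp Require Import generic_quotient.
From mathcomp Require Import all_classical all_reals all_analysis.
From mathcomp Require Import ring.

Set Implicit Arguments.
Unset Strict Implicit.
Unset Printing Implicit Defensive.

Import Order.TTheory GRing.Theory Num.Theory.
Import numFieldNormedType.Exports.
Local Open Scope classical_set_scope.
Local Open Scope ring_scope.
Local Open Scope quotient_scope.

Section Quaternions.
Variable R : realType.
Implicit Types p q r : 'rV[R]_4.

(* The quaternion a + b i + c j + d k is the row vector (a, b, c, d). *)
Definition mkq (a b c d : R) : 'rV[R]_4 := \row_i [:: a; b; c; d]`_i.

Definition q0 q := q 0 (inord 0).
Definition q1 q := q 0 (inord 1).
Definition q2 q := q 0 (inord 2).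
Definition q3 q := q 0 (inord 3).

Definition qmul p q : 'rV[R]_4 := mkq
  (q0 p * q0 q - q1 p * q1 q - q2 p * q2 q - q3 p * q3 q)
  (q0 p * q1 q + q1 p * q0 q + q2 p * q3 q - q3 p * q2 q)
  (q0 p * q2 q - q1 p * q3 q + q2 p * q0 q + q3 p * q1 q)
  (q0 p * q3 q + q1 p * q2 q - q2 p * q1 q + q3 p * q0 q).

Definition qconj q : 'rV[R]_4 := mkq (q0 q) (- q1 q) (- q2 q) (- q3 q).

(* The Euclidean norm; the library norm on 'rV[R]_4 is the sup norm. *)
Definition qnorm q : R := Num.sqrt (\sum_i q 0 i ^+ 2).

Lemma mkqE a b c d :
  (q0 (mkq a b c d) = a) * (q1 (mkq a b c d) = b) *
  (q2 (mkq a b c d) = c) * (q3 (mkq a b c d) = d).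
Proof. by rewrite /q0 /q1 /q2 /q3 !mxE !inordK. Qed.

Lemma mkq_eta q : mkq (q0 q) (q1 q) (q2 q) (q3 q) = q.
Proof.
apply/rowP => -[[|[|[|[|//]]]] lti]; rewrite mxE /=;
  by congr (q 0 _); apply: val_inj; rewrite /= inordK.
Qed.

Lemma qnormE q :
  qnorm q = Num.sqrt (q0 q ^+ 2 + q1 q ^+ 2 + q2 q ^+ 2 + q3 q ^+ 2).
Proof.
rewrite /qnorm !big_ord_recr big_ord0 /= add0r; congr (Num.sqrt (_ + _ + _ + _));
  by congr (q 0 _ ^+ 2); apply: val_inj; rewrite /= inordK.
Qed.

Lemma qnormM p q : qnorm (qmul p q) = qnorm p * qnorm q.
Proof.
rewrite !qnormE -sqrtrM ?addr_ge0 ?sqr_ge0// !mkqE; congr Num.sqrt; ring.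
Qed.

Lemma qmulA : associative qmul.
Proof. by move=> p q r; rewrite /qmul !mkqE; congr mkq; ring. Qed.

Lemma qmul1q q : qmul (mkq 1 0 0 0) q = q.
Proof. by rewrite -[RHS]mkq_eta /qmul !mkqE; congr mkq; ring. Qed.

Lemma qmulq1 q : qmul q (mkq 1 0 0 0) = q.
Proof. by rewrite -[RHS]mkq_eta /qmul !mkqE; congr mkq; ring. Qed.

Lemma qnorm1 : qnorm (mkq 1 0 0 0) = 1.
Proof. by rewrite qnormE !mkqE expr1n expr0n /= !addr0 sqrtr1. Qed.

Lemma qnorm_conj q : qnorm (qconj q) = qnorm q.
Proof. by rewrite !qnormE !mkqE !sqrrN. Qed.

Lemma qnorm1_sq q :
  qnorm q = 1 -> q0 q ^+ 2 + q1 q ^+ 2 + q2 q ^+ 2 + q3 q ^+ 2 = 1.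
Proof.
rewrite qnormE => /(congr1 (fun x => x ^+ 2)).
by rewrite sqr_sqrtr ?expr1n// ?addr_ge0 ?sqr_ge0.
Qed.

Lemma qmulVq q : qnorm q = 1 -> qmul (qconj q) q = mkq 1 0 0 0.
Proof.
by move=> /qnorm1_sq nq; rewrite /qmul !mkqE -nq; congr mkq; ring.
Qed.

Lemma qmulqV q : qnorm q = 1 -> qmul q (qconj q) = mkq 1 0 0 0.
Proof.
by move=> /qnorm1_sq nq; rewrite /qmul !mkqE -nq; congr mkq; ring.
Qed.

End Quaternions.

Definition unit_quat (R : realType) : set 'rV[R]_4 := [set q | qnorm q = 1].

Definition Sp1 (R : realType) : Type := set_type (unit_quat (R := R)).
HB.instance Definition _ (R : realType) := Choice.on (Sp1 R).
HB.instance Definition _ (R : realType) := Topological.on (Sp1 R).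

Section Sp1Group.
Variable R : realType.

Definition mkSp1 (q : 'rV[R]_4) (nq : qnorm q = 1) : Sp1 R :=
  exist _ q (mem_set nq).

Definition qval (h : Sp1 R) : 'rV[R]_4 := sval h.

Lemma qnorm_qval (h : Sp1 R) : qnorm (qval h) = 1.
Proof. by case: h => q /= /set_mem. Qed.

Lemma Sp1M_subproof (g h : Sp1 R) : qnorm (qmul (qval g) (qval h)) = 1.
Proof. by rewrite qnormM !qnorm_qval mulr1. Qed.

Lemma Sp1V_subproof (h : Sp1 R) : qnorm (qconj (qval h)) = 1.
Proof. by rewrite qnorm_conj qnorm_qval. Qed.

Definition Sp1_one : Sp1 R := mkSp1 (qnorm1 R).
Definition Sp1_mul g h : Sp1 R := mkSp1 (Sp1M_subproof g h).
Definition Sp1_inv h : Sp1 R := mkSp1 (Sp1V_subproof h).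

Lemma qval_inj : injective qval.
Proof. exact: val_inj. Qed.

Fact Sp1_mulA : associative Sp1_mul.
Proof. by move=> f g h; apply: qval_inj; apply: qmulA. Qed.
Fact Sp1_mul1 : left_id Sp1_one Sp1_mul.
Proof. by move=> h; apply: qval_inj; apply: qmul1q. Qed.
Fact Sp1_mul1r : right_id Sp1_one Sp1_mul.
Proof. by move=> h; apply: qval_inj; apply: qmulq1. Qed.
Fact Sp1_mulV : left_inverse Sp1_one Sp1_inv Sp1_mul.
Proof. by move=> h; apply: qval_inj; apply/qmulVq/qnorm_qval. Qed.
Fact Sp1_mulVr : right_inverse Sp1_one Sp1_inv Sp1_mul.
Proof. by move=> h; apply: qval_inj; apply/qmulqV/qnorm_qval. Qed.

HB.instance Definition _ := isGroup.Build (Sp1 R)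
  Sp1_mulA Sp1_mul1 Sp1_mul1r Sp1_mulV Sp1_mulVr.

Lemma qnorm_cis (t : R) :
  qnorm (mkq (cos (2 * pi * t)) (sin (2 * pi * t)) 0 0) = 1.
Proof. by rewrite qnormE !mkqE expr0n /= !addr0 cos2Dsin2 sqrtr1. Qed.

(* e^{2 pi i t}; it depends only on t modulo 1. *)
Definition cis (t : R) : Sp1 R := mkSp1 (qnorm_cis t).

Definition circle : set (Sp1 R) := range cis.

End Sp1Group.

Notation Sp1pow R n := {ffun 'I_n -> Sp1 R}.

Section Polytopes.
Variables (R : realType) (m : nat).
Implicit Types (P F : set 'rV[R]_m) (x p u : 'rV[R]_m) (w : 'rV[int]_m).

(* Both R^m and its dual are written as row vectors. *)
Definition pairing x u : R := \sum_j x 0 j * u 0 j.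

Definition real_row w : 'rV[R]_m := map_mx intr w.

(* Affine dimension at least k: k + 1 affinely independent points. *)
Definition affdim_ge (F : set 'rV[R]_m) (k : nat) : Prop :=
  exists (p : 'rV[R]_m) (D : 'M[R]_(k, m)),
    [/\ F p, forall i, F (p + row i D) & row_free D].

Definition has_affdim F (k : nat) : Prop :=
  affdim_ge F k /\ ~ affdim_ge F k.+1.

Definition is_face P F : Prop :=
  exists (u : 'rV[R]_m) (c : R), (forall x, P x -> pairing x u <= c) /\
    F = P `&` [set x | pairing x u = c].

Definition is_vertex P p : Prop := is_face P [set p].

Definition is_edge P F : Prop := is_face P F /\ has_affdim F 1.

(* A face of dimension m - 1; there is none when m = 0. *)
Definition is_facet P F : Prop :=
  is_face P F /\ exists2 k, has_affdim F k & k.+1 = m.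

Definition directed_from (p : 'rV[R]_m) w F : Prop :=
  exists2 T : R, 0 < T &
    F = [set p + t *: real_row w | t in [set t | 0 <= t <= T]].

(* The rows of an invertible integer matrix form a basis of Z^m; as they are
   independent, distinct rows direct distinct edges. *)
Definition delzant_at P p : Prop :=
  exists W : 'M[int]_m,
    [/\ W \in unitmx,
        forall i, exists2 F, is_edge P F & directed_from p (row i W) F &
        forall F, is_edge P F -> F p -> exists i, directed_from p (row i W) F].

Definition primitive_vec w : Prop :=
  forall (n : int) (w' : 'rV[int]_m), w = n *: w' -> n \is a GRing.unit.

Section NormalFan.
Variables (d : nat) (v : 'M[int]_(d, m)) (lam : 'I_d -> R).

Definition polyhedron : set 'rV[R]_m :=
  [set x | forall i, pairing x (real_row (row i v)) <= lam i].

Definition facet_of (i : 'I_d) : set 'rV[R]_m :=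
  polyhedron `&` [set x | pairing x (real_row (row i v)) = lam i].

(* The polytope cut out by v and lam is Delzant, and its facets are exactly
   the d distinct sets facet_of i. *)
Definition delzant_polytope : Prop :=
  [/\ polyhedron !=set0 /\ bounded_set polyhedron,
      forall i, primitive_vec (row i v),
      forall F, is_facet polyhedron F <-> exists i, F = facet_of i,
      injective facet_of &
      forall p, is_vertex polyhedron p -> delzant_at polyhedron p].

End NormalFan.

(* [Some j] stands for -e_j and [None] for e_1 + ... + e_m. *)
Definition simplex_normal (k : option 'I_m) : 'rV[int]_m :=
  if k is Some j then - delta_mx 0 j else const_mx 1.

Definition standard_simplex : set 'rV[R]_m :=
  [set x | (forall j, 0 <= x 0 j) /\ \sum_j x 0 j <= 1].

(* Each of the finitely many hyperplanes is parallel to a facet of the simplex;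
   either of its two sides may be the one that is kept. *)
Definition cut_from_simplex P : Prop :=
  exists (n : nat) (k : 'I_n -> option 'I_m) (s : 'I_n -> bool) (c : 'I_n -> R),
    P = standard_simplex `&` [set x | forall i,
      (-1) ^+ s i * pairing x (real_row (simplex_normal (k i))) <= c i].

End Polytopes.

Section QuaternionicSpace.
Variables (R : realType) (d : nat).
(* A point of H^d is a matrix whose i-th row is the i-th coordinate. *)
Implicit Types (q : 'M[R]_(d, 4)) (l r : Sp1pow R d).

Definition coord_mul l r q : 'M[R]_(d, 4) :=
  \matrix_i qmul (qmul (qval (l i)) (row i q)) (qval (r i)).

Lemma coord_mul1 q : coord_mul 1%g 1%g q = q.
Proof. by apply/row_matrixP => i; rewrite rowK !ffunE qmul1q qmulq1. Qed.

Lemma coord_mulM l r l' r' q :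
  coord_mul l r (coord_mul l' r' q) = coord_mul (l * l')%g (r' * r)%g q.
Proof. by apply/row_matrixP => i; rewrite !rowK !ffunE /= !qmulA. Qed.

Lemma qnorm_coord_mul l r q i :
  qnorm (row i (coord_mul l r q)) = qnorm (row i q).
Proof. by rewrite rowK !qnormM !qnorm_qval mul1r mulr1. Qed.

Definition complex_points : set 'M[R]_(d, 4) :=
  [set z | forall i, q2 (row i z) = 0 /\ q3 (row i z) = 0].

Definition torus : set (Sp1pow R d) := [set t | forall i, circle (t i)].

End QuaternionicSpace.

(* The data (k, alpha, j, beta) of an action of Sp(1)^c on H^d, where
   alpha_i = lexp i and beta_i = - rexp i. *)
Record coord_action (d c : nat) := CoordAction {
  lidx : 'I_d -> 'I_c;
  lexp : 'I_d -> bool;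
  ridx : 'I_d -> 'I_c;
  rexp : 'I_d -> bool
}.

Section CoordAction.
Variables (R : realType) (d c : nat) (A : coord_action d c).
Implicit Types h : Sp1pow R c.

Definition act_left h : Sp1pow R d := [ffun i => h (lidx A i) ^+ lexp A i]%g.
Definition act_right h : Sp1pow R d := [ffun i => h (ridx A i) ^- rexp A i]%g.

Lemma act_left1 : act_left 1%g = 1%g.
Proof. by apply/ffunP => i; rewrite !ffunE expg1n. Qed.

Lemma act_right1 : act_right 1%g = 1%g.
Proof. by apply/ffunP => i; rewrite !ffunE expg1n invg1. Qed.

Lemma act_leftM h h' : act_left (h * h')%g = (act_left h * act_left h')%g.
Proof.
by apply/ffunP => i; rewrite !ffunE; case: (lexp A i); rewrite ?expg1 ?expg0 ?mulg1.
Qed.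

Lemma act_rightM h h' : act_right (h * h')%g = (act_right h' * act_right h)%g.
Proof.
apply/ffunP => i; rewrite !ffunE.
by case: (rexp A i); rewrite ?expg1 ?expg0 ?invgM ?invg1 ?mulg1.
Qed.

End CoordAction.

Section ToricManifold.
Variables (R : realType) (m d : nat) (v : 'M[int]_(d, m)) (lam : 'I_d -> R).

(* The kernel of T^d -> T^m, with T = R / Z, as a subgroup of Sp(1)^d. *)
Definition torus_kernel : set (Sp1pow R d) :=
  [set t | exists theta : 'rV[R]_d, (forall i, t i = cis (theta 0 i)) /\
    exists z : 'rV[int]_m, theta *m map_mx intr v = map_mx intr z].

(* The map phi is the identification of (S^1)^(d-m) with N; the last condition
   determines it and makes it continuous.  Several A, with different
   symmetries of the quotient, may extend the same N. *)
Definition extends_torus_kernel (A : coord_action d (d - m)) : Prop :=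
  exists phi : Sp1pow R (d - m) -> Sp1pow R d,
    [/\ set_bij (@torus R (d - m)) torus_kernel phi,
        forall s s', torus s -> torus s' -> phi (s * s')%g = (phi s * phi s')%g &
        forall s z, torus s -> complex_points z ->
          coord_mul (act_left A s) (act_right A s) z = coord_mul (phi s) 1%g z].

Definition sigma (q : 'M[R]_(d, 4)) (i : 'I_d) : R :=
  - 4^-1 * qnorm (row i q) ^+ 4 + lam i.

(* Restricting a functional to n = ker (y |-> y *m v) gives 0 iff it vanishes
   on every such y. *)
Definition Zset : set 'M[R]_(d, 4) :=
  [set q | forall y : 'rV[R]_d, y *m map_mx intr v = 0 ->
     \sum_i sigma q i * y 0 i = 0].

Lemma Zset_coord_mul l r q : Zset q -> Zset (coord_mul l r q).
Proof.
move=> Zq y /Zq Zy; rewrite -[RHS]Zy; apply: eq_bigr => i _.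
by rewrite /sigma qnorm_coord_mul.
Qed.

Definition Zmul (l r : Sp1pow R d) (q : Zset) : Zset :=
  exist (fun q => q \in Zset) _
    (mem_set (Zset_coord_mul l r (set_mem (svalP q)))).

Lemma Zmul1 q : Zmul 1%g 1%g q = q.
Proof. by apply: val_inj; apply: coord_mul1. Qed.

Lemma ZmulM l r l' r' q : Zmul l r (Zmul l' r' q) = Zmul (l * l')%g (r' * r)%g q.
Proof. by apply: val_inj; apply: coord_mulM. Qed.

Section OrbitSpace.
Variable A : coord_action d (d - m).

Definition hat_act (h : Sp1pow R (d - m)) (q : Zset) : Zset :=
  Zmul (act_left A h) (act_right A h) q.

Lemma hat_act1 q : hat_act 1%g q = q.
Proof. by rewrite /hat_act act_left1 act_right1 Zmul1. Qed.

Lemma hat_actM h h' q : hat_act (h * h')%g q = hat_act h (hat_act h' q).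
Proof. by rewrite /hat_act act_leftM act_rightM ZmulM. Qed.

Definition same_orbit (p q : Zset) : bool := `[< exists h, hat_act h p = q >].

Lemma same_orbit_refl : reflexive same_orbit.
Proof. by move=> q; apply/asboolP; exists 1%g; apply: hat_act1. Qed.

Lemma same_orbit_sym : symmetric same_orbit.
Proof.
by move=> p q; apply/asboolP/asboolP => -[h <-]; exists (h^-1)%g;
  rewrite -hat_actM mulVg hat_act1.
Qed.

Lemma same_orbit_trans : transitive same_orbit.
Proof.
move=> q p r /asboolP[h <-] /asboolP[h' <-]; apply/asboolP.
by exists (h' * h)%g; rewrite hat_actM.
Qed.

Definition orbit_equiv : equiv_rel Zset :=
  EquivRel same_orbit same_orbit_refl same_orbit_sym same_orbit_trans.

Definition orbit_space : Type := quotient_topology {eq_quot orbit_equiv}%qT.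

HB.instance Definition _ := Topological.on orbit_space.
HB.instance Definition _ := Quotient.on orbit_space.

End OrbitSpace.

End ToricManifold.

Section GroupActions.
Variables (G : groupType) (X : topologicalType) (to : G -> X -> X).

Definition is_left_action : Prop :=
  (forall x, to 1%g x = x) /\ (forall g h x, to (g * h)%g x = to g (to h x)).

Definition effective : Prop := forall g, (forall x, to g x = x) -> g = 1%g.

Definition isotropy (x : X) : set G := [set g | to g x = x].

Definition conj_set (K : set G) (g : G) : set G := [set (k ^ g)%g | k in K].

(* K is the isotropy group of a principal orbit: its orbit type is maximal, and
   the orbits of that type form an open dense set. *)
Definition principal_isotropy (K : set G) : Prop :=
  let principal := [set x | exists g, isotropy x = conj_set K g] in
  [/\ exists x, isotropy x = K,
      forall x, exists g, conj_set K g `<=` isotropy x,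
      open principal &
      dense principal].

End GroupActions.

(* Continuity on Sp(1)^n for the product topology. *)
Definition continuous_hom (R : realType) (n d : nat)
    (f : Sp1pow R n -> Sp1pow R d) : Prop :=
  forall i, continuous (fun g : {ptws 'I_n -> Sp1 R} => f (finfun g) i).

(* Main.v *)
(* Up to sign every facet normal v_i is the normal w_k of a facet of the simplex,
   where k ranges over m + 1 directions and the w_k add up to 0.  Boundedness
   forces all m + 1 directions to occur, or all but one, the remaining ones then
   occurring with both signs.

   Draw a star with one leg for each direction, subdivided when both signs occur,
   so that the edges are the facets; a missing direction gives a leg of length 0.
   Root the resulting tree at the tip of a leg k0, a missing one if there is one.
   An element a of Sp(1) at each node, with 1 at the root, acts on the coordinate
   q_i of an edge from x to y by a_x q_i a_y^-1.  The m other tips carry the new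
   group and the inner nodes carry Sp(1)^(d-m): a real cochain on the nodes has a
   coboundary theta with theta v integral exactly when its values at the tips are
   integral, so that the inner nodes extend N.

   If no coordinate of q vanishes, then propagating along the tree from the root
   shows that only a = 1 fixes q.  If q_i = 0, then a = -1 beyond the edge i and
   a = 1 elsewhere fixes q, and some tip lies beyond i.  So the isotropy group of
   [q] is trivial exactly when all q_i are nonzero, which is an open condition; it
   is dense because the fourth powers of the |q_i| range over a convex set that
   meets the open orthant. *)
Require Import Defs.
From HB Require Import structures.
From mathcomp Require Import all_boot all_order all_algebra all_fingroup.
From mathcomp Require Import generic_quotient.
From mathcomp Require Import all_classical all_reals all_analysis.
From mathcomp Require Import ring lra.

Set Implicit Arguments.
Unset Strict Implicit.
Unset Printing Implicit Defensive.

Import Order.TTheory GRing.Theory Num.Theory.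
Import numFieldNormedType.Exports.
Local Open Scope classical_set_scope.
Local Open Scope ring_scope.
Local Open Scope quotient_scope.

(** * Facet normals of a cut simplex *)

Section Pairing.
Variables (R : realType) (m : nat).
Implicit Types x y u : 'rV[R]_m.

Lemma pairingDl x y u : pairing (x + y) u = pairing x u + pairing y u.
Proof. by rewrite -big_split; apply: eq_bigr => j _; rewrite mxE mulrDl. Qed.

Lemma pairingZl a x u : pairing (a *: x) u = a * pairing x u.
Proof. by rewrite mulr_sumr; apply: eq_bigr => j _; rewrite mxE mulrA. Qed.

Lemma pairingZr a x u : pairing x (a *: u) = a * pairing x u.
Proof. by rewrite mulr_sumr; apply: eq_bigr => j _; rewrite mxE mulrCA. Qed.

Lemma pairingNl x u : pairing (- x) u = - pairing x u.
Proof. by rewrite -scaleN1r pairingZl mulN1r. Qed.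

Lemma pairing_suml (I : finType) (F : I -> 'rV[R]_m) u :
  pairing (\sum_i F i) u = \sum_i pairing (F i) u.
Proof.
rewrite /pairing exchange_big; apply: eq_bigr => j _.
by rewrite summxE mulr_suml.
Qed.

Lemma pairing_gt0 u : u != 0 -> 0 < pairing u u.
Proof.
move=> u0; rewrite lt_neqAle sumr_ge0 ?andbT => [|j _]; last exact: sqr_ge0.
apply: contra u0; rewrite eq_sym psumr_eq0 => [/allP u0|j _]; last exact: sqr_ge0.
by apply/eqP/rowP => j; have := u0 j (mem_index_enum j); rewrite mxE mulf_eq0 orbb => /eqP.
Qed.

Lemma real_rowZ (a : int) (w : 'rV[int]_m) :
  real_row R (a *: w) = a%:~R *: real_row R w.
Proof. by apply/rowP => j; rewrite !mxE intrM. Qed.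

Lemma real_row_inj : injective (@real_row R m).
Proof.
move=> w w' /rowP e; apply/rowP => j; have := e j.
by rewrite !mxE => /intr_inj.
Qed.

(** The vectors orthogonal to the m - 1 independent rows of [D] form a line, and the nonzero [u]
    spans it. *)
Lemma orthogonal_hyperplane_colinear k (D : 'M[R]_(k, m)) u w :
  k.+1 = m -> row_free D -> u != 0 ->
  (forall i, pairing (row i D) u = 0) -> (forall i, pairing (row i D) w = 0) ->
  exists t, w = t *: u.
Proof.
move=> km Dfree u0 Du Dw.
have subK z : (forall i, pairing (row i D) z = 0) -> (z <= kermx D^T)%MS.
  move=> Dz; apply/sub_kermxP/rowP => i; rewrite !mxE -[RHS](Dz i).
  by apply: eq_bigr => j _; rewrite !mxE mulrC.
have rkK : \rank (kermx D^T) = 1%N.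
  by rewrite mxrank_ker mxrank_tr (eqP Dfree) -km subSnn.
have : (u == kermx D^T)%MS.
  rewrite -(mxrank_leqif_eq (subK _ Du)) rkK.
  by rewrite rank_rV u0.
move=> /eqmxP uK; have := subK _ Dw; rewrite -uK => /sub_rVP[t ->].
by exists t.
Qed.

End Pairing.

Section SimplexNormals.
Variables (R : realType) (m : nat).
Implicit Types (x u : 'rV[R]_m) (k l : option 'I_m).

(** This is the vertex of the standard simplex opposite to the facet with normal
    [simplex_normal k]. *)
Definition simplex_vertex k : 'rV[R]_m := if k is Some j then delta_mx 0 j else 0.

Lemma pairing_simplex_normal_Some x j :
  pairing x (real_row R (simplex_normal (Some j))) = - x 0 j.
Proof.
rewrite /pairing (bigD1 j) //= big1 ?addr0 => [|l lj].
  by rewrite !mxE !eqxx mulrN1z mulrN1.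
by rewrite !mxE eqxx (negbTE lj) oppr0 mulr0.
Qed.

Lemma pairing_simplex_normal_None x :
  pairing x (real_row R (simplex_normal None)) = \sum_j x 0 j.
Proof. by apply: eq_bigr => j _; rewrite !mxE mulr1. Qed.

(** Moving along an edge of the simplex changes only the pairings with the normals of the two facets
    opposite to its ends. Such edges serve below as recession directions. *)
Lemma simplex_vertex_normal k1 k2 k :
  pairing (simplex_vertex k1 - simplex_vertex k2) (real_row R (simplex_normal k))
    = (k == k2)%:R - (k == k1)%:R.
Proof.
have sumE l : \sum_j (simplex_vertex l) 0 j = (l != None)%:R.
  case: l => [i|] /=; last by apply: big1 => j _; rewrite mxE.
  rewrite (bigD1 i) //= mxE !eqxx big1 ?addr0 // => j ji.
  by rewrite mxE eqxx (negbTE ji).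
rewrite pairingDl pairingNl; case: k => [j|].
  have vE l : (simplex_vertex l) 0 j = (Some j == l)%:R.
    by case: l => [i|]; rewrite mxE ?eqxx.
  by rewrite !pairing_simplex_normal_Some !vE opprK addrC.
rewrite !pairing_simplex_normal_None !sumE ![None == _]eq_sym.
by case: (k1 == None); case: (k2 == None); rewrite /= ?subr0 ?sub0r ?subrr.
Qed.

Lemma simplex_vertex_neq k1 k2 :
  k1 != k2 -> simplex_vertex k1 - simplex_vertex k2 != 0.
Proof.
move=> k12; apply/eqP => e; have := simplex_vertex_normal k1 k2 k1.
rewrite e eqxx (negbTE k12) /pairing big1 => [|j _]; last by rewrite mxE mul0r.
by move/eqP; rewrite sub0r eq_sym oppr_eq0 oner_eq0.
Qed.

Lemma cut_from_simplex_constraints (P : set 'rV[R]_m) : cut_from_simplex P ->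
  exists (I : finType) (k : I -> option 'I_m) (s : I -> bool) (c : I -> R),
    P = [set x | forall i,
      pairing x (real_row R ((-1) ^+ s i *: simplex_normal (k i))) <= c i].
Proof.
have signE (s : bool) x l :
    pairing x (real_row R ((-1) ^+ s *: simplex_normal l)) =
    (-1) ^+ s * pairing x (real_row R (simplex_normal l)).
  by rewrite real_rowZ pairingZr rmorphXn /= mulrN1z.
move=> [n [k [s [c ->]]]].
pose K (i : option 'I_m + 'I_n) := match i with inl l => l | inr j => k j end.
pose S (i : option 'I_m + 'I_n) := if i is inr j then s j else false.
pose C (i : option 'I_m + 'I_n) := match i with inl l => (l == None)%:R | inr j => c j end.
exists _, K, S, C; apply/seteqP; split => x /=.
  move=> [[x0 x1] xc] [[j|]|i]; rewrite signE /= ?expr0 ?mul1r.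
  - by rewrite pairing_simplex_normal_Some oppr_le0.
  - by rewrite pairing_simplex_normal_None.
  - exact: xc.
move=> H; split; first split.
- move=> j; have := H (inl (Some j)); rewrite signE /= expr0 mul1r.
  by rewrite pairing_simplex_normal_Some oppr_le0.
- have := H (inl None); rewrite signE /= expr0 mul1r.
  by rewrite pairing_simplex_normal_None.
- by move=> i; have := H (inr i); rewrite signE.
Qed.

End SimplexNormals.

Section CutPolytope.
Variables (R : realType) (m d : nat) (v : 'M[int]_(d, m)) (lam : 'I_d -> R).
Hypothesis hP : delzant_polytope v lam.
Let P := polyhedron v lam.
Let nv i := real_row R (row i v).
Implicit Types (x u : 'rV[R]_m).

Lemma primitive_neq0 (w : 'rV[int]_m) : primitive_vec w -> w != 0.
Proof.
by move=> /(_ 0 0) wp; apply/eqP => w0; move: wp; rewrite w0 scale0r unitr0 => /(_ erefl).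
Qed.

Let nv_neq0 i : nv i != 0.
Proof.
case: hP => _ /(_ i)/primitive_neq0 vi0 _ _ _; apply: contra vi0 => /eqP e.
by apply/eqP/(@real_row_inj R); rewrite [LHS]e; apply/rowP => j; rewrite !mxE.
Qed.

Lemma facet_of_affdim i : exists2 k, affdim_ge (facet_of v lam i) k & k.+1 = m.
Proof.
case: hP => _ _ /(_ (facet_of v lam i))[_ H] _ _.
by case: (H (ex_intro _ i erefl)) => _ [k [? _] ?]; exists k.
Qed.

Lemma facet_of_nonempty i : exists x, facet_of v lam i x.
Proof. by have [k [p [D [? _ _]]] _] := facet_of_affdim i; exists p. Qed.

(** As facets are nonempty, [lam i] is the maximum on [P] of the pairing with the i-th normal. Equal
    normals thus give equal facets. *)
Lemma facet_row_inj : injective (fun i => row i v).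
Proof.
move=> i i' /= e; have [_ _ _ inj _] := hP; apply: inj.
have [x [Px xi]] := facet_of_nonempty i; have [y [Py yi]] := facet_of_nonempty i'.
have lamE : lam i = lam i'.
  have := Py i; have := Px i'; move: xi yi => /=; rewrite e => -> -> *.
  by apply/eqP; rewrite eq_le; apply/andP.
by rewrite /facet_of e lamE.
Qed.

(** Otherwise the bounded set [P] would contain a ray in direction [u]. *)
Lemma recession_eq0 u : (forall i, pairing u (nv i) <= 0) -> u = 0.
Proof.
move=> u_le0; apply/eqP/negP => /negP u0.
have [[[p Pp] [M [_ PM]]] _ _ _ _] := hP.
pose K := `|M| + 1; have MK : M < K by rewrite ltr_pwDr ?ler_norm.
have u_gt0 : 0 < `|u| by rewrite normr_gt0.
(* This makes the norm of [t *: u] equal to K + |p| + 1, so that [p + t *: u] has norm at least K +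
   1. *)
pose t := (K + `|p| + 1) / `|u|.
have t_ge0 : 0 <= t by rewrite divr_ge0 ?addr_ge0.
have /(PM _ MK) : P (p + t *: u).
  move=> i; rewrite pairingDl pairingZl -[leRHS]addr0 lerD ?Pp //.
  by rewrite mulr_ge0_le0 ?u_le0.
apply/negP; rewrite -ltNge; have := lerB_normD (t *: u) p.
rewrite addrC [t *: u + p]addrC normrZ ger0_norm // /t divfK ?gt_eqF //.
by move=> ?; lra.
Qed.

Lemma facet_colinear i k (D : 'M[R]_(k, m)) p u c :
  k.+1 = m -> row_free D ->
  facet_of v lam i p -> (forall j, facet_of v lam i (p + row j D)) ->
  pairing p u = c -> (forall j, pairing (p + row j D) u = c) ->
  exists t, u = t *: nv i.
Proof.
move=> km Dfree [_ pi] Di pu Du.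
apply: (orthogonal_hyperplane_colinear km Dfree (nv_neq0 i)) => j.
  have [_ /= /eqP] := Di j; rewrite pairingDl pi -subr_eq0.
  by rewrite addrC addKr => /eqP.
by have := Du j; rewrite pairingDl pu => /eqP; rewrite -subr_eq0 addrC addKr => /eqP.
Qed.

(** If [P] lay in the hyperplane of facet i, all facet normals would be parallel and every facet
    would be all of [P]. Then i would be the only index, and [- nv i] a recession direction. *)
Lemma facet_strict i : exists2 x, P x & pairing x (nv i) < lam i.
Proof.
apply: contrapT => H.
have Pi x : P x -> pairing x (nv i) = lam i.
  move=> Px; apply/eqP/negP => /negP ne; apply: H; exists x => //.
  by rewrite lt_neqAle ne; apply: Px.
have single i' : i' = i.
  have [_ _ _ inj _] := hP; apply: inj.
  have [k [p [D [Fp FD Dfree]]] km] := facet_of_affdim i'.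
  have [t tE] : exists t, nv i = t *: nv i'.
    apply: (facet_colinear km Dfree Fp FD (c := lam i)) => [|j].
      by case: Fp => + _; apply: Pi.
    by case: (FD j) => + _; apply: Pi.
  have t0 : t != 0.
    by apply/eqP => t0; move: (nv_neq0 i); rewrite tE t0 scale0r eqxx.
  have lamE : lam i = t * lam i'.
    by case: Fp => Pp /= <-; rewrite -(Pi p Pp) tE pairingZr.
  apply/seteqP; split => x [Px /= xi]; split => //=; first exact: Pi.
  by apply: (mulfI t0); rewrite -lamE -pairingZr -[t *: _]tE Pi.
have : - nv i = 0.
  apply: recession_eq0 => j; rewrite (single j) pairingNl oppr_le0.
  exact/ltW/pairing_gt0.
by move/eqP; rewrite oppr_eq0 (negbTE (nv_neq0 i)).
Qed.

(** Average d points of [P], the i-th of which is strict for the i-th constraint. *)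
Lemma polyhedron_interior_point :
  exists x, forall i, pairing x (nv i) < lam i.
Proof.
have [[[p Pp] _] _ _ _ _] := hP.
have [d0|d_gt0] := posnP d.
  by exists p => i; have := ltn_ord i; rewrite [X in (_ < X)%N]d0.
have /choice[x xP] : forall i, exists x, P x /\ pairing x (nv i) < lam i.
  by move=> i; have [x] := facet_strict i; exists x.
exists ((d%:R)^-1 *: \sum_i x i) => i.
rewrite pairingZl pairing_suml -[ltRHS](mulKf (x := d%:R)) ?pnatr_eq0 -?lt0n //.
rewrite ltr_pM2l ?invr_gt0 ?ltr0n // mulr_natl -[in ltRHS](card_ord d) -sumr_const.
rewrite (bigD1 i) //= [ltRHS](bigD1 i) //=; apply: ltr_leD; first by case: (xP i).
by apply: ler_sum => j _; case: (xP j) => /(_ i).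
Qed.

Hypothesis hcut : cut_from_simplex P.

(** Facet i has dimension m - 1, so it spans the hyperplane of one of the constraints that cut out
    [P]. Its normal is parallel to the normal [w a] of that constraint, and primitivity leaves only
    the sign free. *)
Lemma facet_normal_simplex i : exists (k : option 'I_m) (s : bool),
  row i v = (-1) ^+ s *: simplex_normal k.
Proof.
have [I [k [s [c PE]]]] := cut_from_simplex_constraints hcut.
pose w a : 'rV[int]_m := (-1) ^+ s a *: simplex_normal (k a).
have [n [p [D [Fp FD Dfree]]] nm] := facet_of_affdim i.
pose x := (m%:R)^-1 *: (p + \sum_j (p + row j D)).
have m0 : m%:R != 0 :> R by rewrite pnatr_eq0 -nm.
have xE u : m%:R * pairing x u = pairing p u + \sum_j pairing (p + row j D) u.
  by rewrite pairingZl mulVKf // pairingDl pairing_suml.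
have mE (y : R) : m%:R * y = y + \sum_(j < n) y.
  by rewrite -nm sumr_const card_ord mulr_natl mulrS.
have Pp : P p by case: Fp.
have PD j : P (p + row j D) by case: (FD j).
have xi : pairing x (nv i) = lam i.
  apply: (mulfI m0); rewrite xE; case: (Fp) => _ /= ->.
  by under eq_bigr do rewrite (proj2 (FD _)); rewrite mE.
have PI y a : P y -> pairing y (real_row R (w a)) <= c a by rewrite PE; apply.
(* At the barycentre of a full-dimensional simplex in the facet some constraint
   is tight: otherwise the barycentre could be moved across the facet. *)
have [a xa] : exists a, pairing x (real_row R (w a)) = c a.
  apply: contrapT => H.
  have strict a : pairing x (real_row R (w a)) < c a.
    rewrite lt_neqAle; apply/andP; split.
      by apply/eqP => xa; apply: H; exists a.
    rewrite -(ler_pM2l (x := m%:R)) ?ltr0n -?nm // xE mE.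
    by rewrite lerD ?PI // ler_sum // => j _; apply: PI.
  have [e e0 He] : exists2 e : R, 0 < e & P (x + e *: nv i).
    suff : \forall e \near 0^'+, P (x + e *: nv i).
      move=> Pe; near (0 : R)^'+ => e; exists e; first by [].
      by near: e.
    rewrite PE; apply: filter_forall => a /=.
    have : (fun e : R => pairing x (real_row R (w a)) + e * pairing (nv i) (real_row R (w a)))
      @ 0^'+ --> pairing x (real_row R (w a)) + 0 * pairing (nv i) (real_row R (w a)).
      apply: cvgD; first exact: cvg_cst.
      by apply: cvgMl; apply: cvg_at_right_filter; apply: cvg_id.
    rewrite mul0r addr0 => /cvgr_lt/(_ _ (strict a)); apply: filterS => e.
    by rewrite pairingDl pairingZl => /ltW.
  have := He i; rewrite pairingDl pairingZl xi -[leRHS]addr0 lerD2l leNgt.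
  by rewrite mulr_gt0 // pairing_gt0.
(* The slacks of constraint [a] at the m points are nonnegative and sum to 0. *)
have tight : pairing p (real_row R (w a)) = c a /\
    forall j, pairing (p + row j D) (real_row R (w a)) = c a.
  have := xE (real_row R (w a)); rewrite xa mE => e.
  have /eqP : (c a - pairing p (real_row R (w a))) +
      \sum_j (c a - pairing (p + row j D) (real_row R (w a))) = 0.
    by rewrite sumrB addrACA e -opprD subrr.
  rewrite paddr_eq0 ?subr_ge0 ?PI //; last first.
    by apply: sumr_ge0 => j _; rewrite subr_ge0 PI.
  rewrite psumr_eq0 => [|j _]; last by rewrite subr_ge0 PI.
  rewrite subr_eq0 => /andP[/eqP <- /allP H]; split => // j.
  by have := H j (mem_index_enum j); rewrite /= subr_eq0 => /eqP <-.
have [t tE] := facet_colinear nm Dfree Fp FD (proj1 tight) (proj2 tight).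
(* An entry 1 or -1 of [w a] makes the ratio of [row i v] to [w a] the integer [z] below, which
   primitivity then applies to. *)
have [j wj] : exists j, w a 0 j ^+ 2 = 1.
  rewrite /w; case: (k a) => [j|].
    by exists j; rewrite !mxE !eqxx mulrN1 sqrrN sqrr_sign.
  have m_gt0 : (0 < m)%N by rewrite -nm.
  by exists (Ordinal m_gt0); rewrite !mxE mulr1 sqrr_sign.
pose z := v i j * w a 0 j.
have vE : row i v = z *: w a.
  apply: (@real_row_inj R); rewrite real_rowZ tE scalerA.
  have -> : z%:~R * t = 1.
    have e : (w a 0 j)%:~R = t * (v i j)%:~R.
      by have /rowP/(_ j) := tE; rewrite !mxE.
    by rewrite intrM -mulrA mulrC -mulrA -e -intrM -expr2 wj.
  by rewrite scale1r.
have [_ /(_ i) vprim _ _ _] := hP.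
have /orP[/eqP z1|/eqP z1] := vprim _ _ vE; exists (k a).
  by exists (s a); rewrite vE z1 scale1r.
by exists (~~ s a); rewrite vE z1 /w scalerA mulN1r signrN.
Unshelve. all: by end_near. Qed.

(** If direction [k] lacked the sign [s], then a multiple by 1 or -1 of the edge from vertex [k0] to
    vertex [k] would be a recession direction: it is parallel to the facets of all other directions,
    and [k0] itself does not occur. *)
Lemma facet_both_signs (kap : 'I_d -> option 'I_m) (eps : 'I_d -> bool) k0 k s :
  (forall i, row i v = (-1) ^+ eps i *: simplex_normal (kap i)) ->
  (forall i, kap i != k0) -> k != k0 -> exists i, kap i = k /\ eps i = s.
Proof.
move=> vE k0_missing kk0; apply: contrapT => H.
suff /eqP : (-1) ^+ (~~ s) *: (simplex_vertex R k - simplex_vertex R k0) = 0.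
  by rewrite scaler_eq0 signr_eq0 (negbTE (simplex_vertex_neq R kk0)).
apply: recession_eq0 => i; rewrite /nv vE real_rowZ pairingZl pairingZr.
rewrite simplex_vertex_normal (negbTE (k0_missing i)) sub0r.
have [ki|_] := eqVneq (kap i) k; last by rewrite oppr0 !mulr0.
have <- : ~~ s = eps i.
  by case: (eps i =P s) => [e|]; [case: H; exists i | case: (s); case: (eps i)].
rewrite rmorphXn /= mulrN1z mulrA -expr2 sqrr_sign mul1r; lra.
Qed.
End CutPolytope.

(** * The tree of facets *)

(* The tree behind the action: edge [i] carries the coordinate q_i and joins the
   node [i] to [parent i], where [None] is the root.  An element a of Sp(1)^d,
   extended by 1 at the root, sends q_i to a_x q_i a_y^-1, where x and y are the
   left and right ends of the edge.  The factors of Sp(1)^m sit at the nodes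
   [gnode] and those of the second group at the nodes [hnode]. *)
Record quat_tree (d m c : nat) := QuatTree {
  parent : 'I_d -> option 'I_d;
  child_left : 'I_d -> bool;
  depth : 'I_d -> nat;
  gnode : 'I_m -> 'I_d;
  hnode : 'I_c -> 'I_d;
  hnode_near : 'I_d -> 'I_c;
  depth_parent : forall i j, parent i = Some j -> (depth j < depth i)%N;
  gnode_inj : injective gnode;
  hnode_inj : injective hnode;
  gnode_neq_hnode : forall j l, gnode j <> hnode l;
  gnode_or_hnode : forall i, (exists j, gnode j = i) \/ (exists j, hnode j = i);
  hnode_child : forall j, exists i, parent i = Some (hnode j)
}.

Section TreeEnds.
Variables (d m c : nat) (t : quat_tree d m c).

Definition left_end (i : 'I_d) := if child_left t i then Some i else parent t i.
Definition right_end (i : 'I_d) := if child_left t i then parent t i else Some i.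

Definition extend_root (T : Type) (a0 : T) (a : 'I_d -> T) (x : option 'I_d) : T :=
  if x is Some i then a i else a0.

(** This is the coboundary of a cochain on the nodes that vanishes at the root. *)
Definition edge_diff (V : zmodType) (a : 'I_d -> V) (i : 'I_d) : V :=
  extend_root 0 a (left_end i) - extend_root 0 a (right_end i).

End TreeEnds.

Section FacetTree.
Variables (d m : nat) (kap : 'I_d -> option 'I_m) (eps : 'I_d -> bool).
Variable k0 : option 'I_m.
Hypothesis kap_eps_inj : forall i j, kap i = kap j -> eps i = eps j -> i = j.
Hypothesis k0P : (forall k, exists i, kap i = k) \/
  (forall k s, k != k0 -> exists i, kap i = k /\ eps i = s).
Hypothesis m_gt0 : 'I_d -> (0 < m)%N.

(* [F k s] is the facet with normal (-1)^s w_k, if any.  On a subdivided leg the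
   edge with s = false is the outer one.  The leg of k0 is traversed from its tip,
   the root, to the center of the star, the other legs from the center to the tip. *)
Let F k s := [pick i | (kap i == k) && (eps i == s)].

Let F_some k s i : F k s = Some i -> kap i = k /\ eps i = s.
Proof. by rewrite /F; case: pickP => // j /andP[/eqP ? /eqP ?] [<-]. Qed.

Let F_mk i k s : kap i = k -> eps i = s -> F k s = Some i.
Proof.
move=> ki si; rewrite /F; case: pickP => [j /andP[/eqP kj /eqP sj]|/(_ i)].
  by congr Some; apply: kap_eps_inj; rewrite ?ki ?si.
by rewrite ki si !eqxx.
Qed.

(** A node is named after the edge that leads to it from the root, so the center of the star is the
    last edge of the leg of [k0], or the root itself when that leg has length 0. *)
Let center := if F k0 true is Some i then Some i else F k0 false.

Let par i :=
  if kap i == k0 then (if eps i then F k0 false else None)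
  else if eps i then center
  else if F (kap i) true is Some j then Some j else center.

(** The side of the child compensates the sign of the normal and the direction of traversal, so that
    the signed differences along any leg telescope to tip minus center. *)
Let chl i := (kap i != k0) (+) eps i.

(** Levels 0 and 1 belong to the leg of [k0], levels 2 and 3 to the inner and outer edges of the
    other legs. Missing edges leave gaps, which is harmless as only strict growth matters. *)
Let dep i := (if kap i == k0 then nat_of_bool (eps i) else 3 - eps i)%N.

Let outer k := if F k false is Some i then Some i else F k true.

Let center_some i : center = Some i -> kap i = k0.
Proof.
rewrite /center; case E: (F k0 true) => [j|]; last by case/F_some.
by case=> <-; case: (F_some E).
Qed.

Let outer_some k i : outer k = Some i -> kap i = k.
Proof.
rewrite /outer; case E: (F k false) => [j|]; last by case/F_some.
by case=> <-; case: (F_some E).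
Qed.

Let outerP k : k != k0 -> exists i, outer k = Some i.
Proof.
move=> kk0; rewrite /outer; case E: (F k false) => [i|]; first by exists i.
have [i ki] : exists i, kap i = k.
  by case: k0P => [/(_ k)//|/(_ k true kk0)[i []]]; exists i.
exists i; apply: F_mk => //; case si: (eps i) => //.
by rewrite (F_mk ki si) in E.
Qed.

Let dep_par i j : par i = Some j -> (dep j < dep i)%N.
Proof.
rewrite /par /dep; have [ki|ki] := eqVneq (kap i) k0.
  by case si: (eps i) => // /F_some[-> ->]; rewrite eqxx.
have centerE : center = Some j -> ((if kap j == k0 then nat_of_bool (eps j) else 3 - eps j) < 3 - eps i)%N.
  by move=> /center_some ->; rewrite eqxx; case: (eps j); case: (eps i).
case si: (eps i); first by rewrite -si.
case E: (F _ _) => [l|]; last by rewrite -si.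
by case=> <-; case: (F_some E) => -> ->; rewrite (negbTE ki).
Qed.

Section EdgeDiff.
Variables (V : zmodType) (al : 'I_d -> V).
Let nv := extend_root 0 al.
Let del i : V := nv (if chl i then Some i else par i) - nv (if chl i then par i else Some i).
Let leg k : V := \sum_(i | kap i == k) (if eps i then - del i else del i).

Let legE k : leg k = (if F k false is Some i then del i else 0) -
  (if F k true is Some i then del i else 0).
Proof.
rewrite /leg (bigID eps) /= addrC; congr (_ + _).
  case E: (F k false) => [i|].
    case: (F_some E) => ki si; rewrite (big_pred1 i) ?si // => j /=.
    apply/andP/eqP => [[/eqP kj /negbTE sj]|->]; last by rewrite ki si eqxx.
    by apply: kap_eps_inj; rewrite ?ki ?si.
  by apply: big_pred0 => j; apply/andP => -[/eqP kj /negbTE sj]; rewrite (F_mk kj sj) in E.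
case E: (F k true) => [i|].
  case: (F_some E) => ki si; rewrite (big_pred1 i) ?si // => j /=.
  apply/andP/eqP => [[/eqP kj sj]|->]; last by rewrite ki si eqxx.
  by apply: kap_eps_inj; rewrite ?ki ?si.
by rewrite oppr0; apply: big_pred0 => j; apply/andP => -[/eqP kj sj]; rewrite (F_mk kj sj) in E.
Qed.

Lemma leg_sum_other k : k != k0 -> leg k = nv (outer k) - nv center.
Proof.
move=> kk0; rewrite legE /outer /del /chl /par.
case E: (F k false) => [i|]; case E': (F k true) => [i'|].
- have [ki si] := F_some E; have [ki' si'] := F_some E'.
  by rewrite ki ki' si si' kk0 (negbTE kk0) /= E' opprB addrA subrK.
- have [ki si] := F_some E.
  by rewrite ki si kk0 (negbTE kk0) /= E' subr0.
- have [ki' si'] := F_some E'.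
  by rewrite ki' si' kk0 (negbTE kk0) /= sub0r opprB.
by case: (outerP kk0) => i; rewrite /outer E E'.
Qed.

Lemma leg_sum_root : leg k0 = - nv center.
Proof.
rewrite legE /center /del /chl /par.
case E: (F k0 false) => [i|]; case E': (F k0 true) => [i'|].
- have [ki si] := F_some E; have [ki' si'] := F_some E'.
  by rewrite ki ki' si si' eqxx /= sub0r opprB addKr.
- by have [ki si] := F_some E; rewrite ki si eqxx /= sub0r subr0.
- by have [ki' si'] := F_some E'; rewrite ki' si' eqxx /= subr0 sub0r.
by rewrite /= subr0 oppr0.
Qed.

End EdgeDiff.

(** The list [e] enumerates the m directions other than [k0]. Their tips become the [gnode]s and the
    remaining d - m edges the [hnode]s. In the last formula the value at the center cancels between
    the two legs, and the root contributes 0. *)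
Lemma facet_tree_exists :
  exists (t : quat_tree d m (d - m)) (e : 'I_m -> option 'I_m),
  [/\ forall j, e j != k0,
      forall k, k != k0 -> exists j, e j = k &
      forall (V : zmodType) (al : 'I_d -> V) j,
      \sum_(i | kap i == e j) (if eps i then - edge_diff t al i else edge_diff t al i) -
      \sum_(i | kap i == k0) (if eps i then - edge_diff t al i else edge_diff t al i)
      = al (gnode t j)].
Proof.
have cardK : #|[set~ k0]%SET| = m by rewrite cardsC1 card_option card_ord.
pose e j : option 'I_m := enum_val (cast_ord (esym cardK) j).
have e_inj : injective e by move=> j l /enum_val_inj/cast_ord_inj.
have eK j : e j != k0 by have := enum_valP (cast_ord (esym cardK) j); rewrite !inE.
have e_onto k : k != k0 -> exists j, e j = k.
  move=> kk0; have kK : k \in [set~ k0]%SET by rewrite !inE.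
  by exists (cast_ord cardK (enum_rank_in kK k)); rewrite /e cast_ordK enum_rankK_in.
have /choice[g gE] : forall j, exists i, outer (e j) = Some i.
  by move=> j; apply: outerP.
have kg j : kap (g j) = e j by apply: outer_some.
have g_inj : injective g by move=> j l gjl; apply: e_inj; rewrite -!kg gjl.
pose H := (~: (g @: 'I_m))%SET.
have cardH : #|H| = (d - m)%N.
  by rewrite cardsCs finset.setCK card_imset // !card_ord.
pose h j : 'I_d := enum_val (cast_ord (esym cardH) j).
have h_inj : injective h by move=> j l /enum_val_inj/cast_ord_inj.
have hH j : h j \in H by exact: enum_valP.
have h_onto i : i \in H -> exists j, h j = i.
  by move=> iH; exists (cast_ord cardH (enum_rank_in iH i)); rewrite /h cast_ordK enum_rankK_in.
have gNh j l : g j <> h l.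
  by move=> gh; have := hH l; rewrite -gh inE imset_f.
have g_or_h i : (exists j, g j = i) \/ (exists j, h j = i).
  have [/imsetP[j _ ->]|iH] := boolP (i \in g @: 'I_m)%SET; first by left; exists j.
  by right; apply: h_onto; rewrite inE.
have outer_g k i : k != k0 -> outer k = Some i -> exists j, g j = i.
  by move=> /e_onto[j <-]; rewrite gE => -[<-]; exists j.
have H_k0 i : kap i = k0 -> i \in H.
  by move=> ki; rewrite inE; apply/imsetP => -[j _ ij]; have := eK j; rewrite -kg -ij ki eqxx.
have H_inner k i : k != k0 -> outer k <> Some i -> kap i = k -> i \in H.
  move=> kk0 ok ki; rewrite inE; apply/imsetP => -[j _ ij]; apply: ok.
  by rewrite -ki ij kg gE.
(* A default index is required, hence an edge that is not a tip. If [i] is a tip, then either the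
   leg of [k0] has an edge, or some other leg has two, of which the inner one is no tip. *)
have near (i : 'I_d) : exists j : 'I_(d - m), True.
  suff [l lH] : exists l, l \in H by have [j _] := h_onto _ lH; exists j.
  have [iH|] := boolP (i \in H); first by exists i.
  rewrite inE negbK => /imsetP[j _ _].
  case: k0P => [/(_ k0)[l kl]|both]; first by exists l; apply: H_k0.
  have [[l [kl sl]] [l' [kl' sl']]] := (both _ true (eK j), both _ false (eK j)).
  exists l; apply: H_inner kl => //; rewrite /outer (F_mk kl' sl') => -[ll'].
  by rewrite -ll' sl' in sl.
have /choice[hn _] := near.
(* The center has a child on any other leg, and one exists because m is positive. A node before the
   center on the leg of [k0], or inside another leg, has the other edge of its leg as child. *)
have child j : exists i, par i = Some (h j).
  move: (h j) (hH j) => i iH; have [ki|ki] := eqVneq (kap i) k0.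
    have [ci|ci] := eqVneq center (Some i).
      have kk0 := eK (Ordinal (m_gt0 i)); set k := e _ in kk0.
      case E: (F k true) => [l|].
        by have [kl sl] := F_some E; exists l; rewrite /par kl sl (negbTE kk0).
      have [l] := outerP kk0; rewrite /outer E.
      case E': (F k false) => [l'|//] _; have [kl' sl'] := F_some E'.
      by exists l'; rewrite /par kl' sl' (negbTE kk0) E.
    move: ci; rewrite /center; case E: (F k0 true) => [l|].
      have [kl sl] := F_some E => li; exists l; rewrite /par kl sl eqxx.
      apply: F_mk => //; apply: contra_neqF li => si.
      by congr Some; apply: kap_eps_inj; rewrite ?kl ?sl.
    case si: (eps i); first by rewrite (F_mk ki si) in E.
    by rewrite (F_mk ki si) eqxx.
  have outerN : outer (kap i) <> Some i.
    by move=> /(outer_g _ _ ki)[l li]; move: iH; rewrite inE -li imset_f.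
  move: outerN; rewrite /outer; case E: (F (kap i) false) => [l|] ne; last first.
    case si: (eps i); last by rewrite (F_mk erefl si) in E.
    by case: ne; apply: F_mk.
  have [kl sl] := F_some E; exists l; rewrite /par kl sl (negbTE ki).
  case si: (eps i); first by rewrite (F_mk erefl si).
  by case: ne; rewrite -E; apply: F_mk.
pose t := @QuatTree d m (d - m) par chl dep g h hn dep_par g_inj h_inj gNh g_or_h child.
exists t, e; split => // V al j.
rewrite [X in X - _](leg_sum_other al (eK j)) [X in _ - X](leg_sum_root al) gE /=.
by rewrite opprK subrK.
Qed.
End FacetTree.

(** * Unit quaternions *)

Section UnitQuaternions.
Variable R : realType.
Implicit Types (x y z : 'rV[R]_4) (a b : Sp1 R) (s u : R).

Lemma qmulDl x y z : qmul (x + y) z = qmul x z + qmul y z.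
Proof.
rewrite -[RHS]mkq_eta /qmul; congr mkq; rewrite /q0 /q1 /q2 /q3 !mxE !inordK //=; ring.
Qed.

Lemma qmulDr x y z : qmul x (y + z) = qmul x y + qmul x z.
Proof.
rewrite -[RHS]mkq_eta /qmul; congr mkq; rewrite /q0 /q1 /q2 /q3 !mxE !inordK //=; ring.
Qed.

Lemma qmulNl x y : qmul (- x) y = - qmul x y.
Proof.
rewrite -[RHS]mkq_eta /qmul; congr mkq; rewrite /q0 /q1 /q2 /q3 !mxE !inordK //=; ring.
Qed.

Lemma qmulNr x y : qmul x (- y) = - qmul x y.
Proof.
rewrite -[RHS]mkq_eta /qmul; congr mkq; rewrite /q0 /q1 /q2 /q3 !mxE !inordK //=; ring.
Qed.

Lemma qnorm_ge0 x : 0 <= qnorm x.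
Proof. exact: sqrtr_ge0. Qed.

Lemma qnorm_eq0 x : (qnorm x == 0) = (x == 0).
Proof.
rewrite /qnorm sqrtr_eq0; apply/idP/eqP => [x_le0|->]; last first.
  by rewrite big1 // => i _; rewrite mxE expr0n.
have : \sum_i x 0 i ^+ 2 == 0.
  by rewrite eq_le x_le0 sumr_ge0 // => i _; rewrite sqr_ge0.
rewrite psumr_eq0 => [/allP H|i _]; last exact: sqr_ge0.
by apply/rowP => i; have := H i (mem_index_enum i); rewrite mxE sqrf_eq0 => /eqP.
Qed.

Lemma qnormZ s x : qnorm (s *: x) = `|s| * qnorm x.
Proof.
rewrite /qnorm -sqrtr_sqr -sqrtrM ?sqr_ge0 // mulr_sumr.
by congr Num.sqrt; apply: eq_bigr => i _; rewrite mxE exprMn.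
Qed.

Lemma qnorm_exp4_gt0 x : (0 < qnorm x ^+ 4) = (x != 0).
Proof. by rewrite lt0r exprn_ge0 ?qnorm_ge0 // andbT expf_eq0 /= qnorm_eq0. Qed.

(** The direction chosen at 0 is arbitrary, but having one allows a vanishing coordinate to be
    pushed off 0. *)
Lemma quat_direction x : exists y, qnorm y = 1 /\ x = qnorm x *: y.
Proof.
have [->|x0] := eqVneq x 0.
  by exists (mkq 1 0 0 0); rewrite qnorm1; have /eqP -> : qnorm (0 : 'rV[R]_4) == 0;
    rewrite ?scale0r // qnorm_eq0.
have nx : qnorm x != 0 by rewrite qnorm_eq0.
exists ((qnorm x)^-1 *: x).
by rewrite qnormZ normfV ger0_norm ?qnorm_ge0 // mulVf // scalerA divff // scale1r.
Qed.

Lemma qval1 : qval 1%g = mkq 1 0 0 0 :> 'rV[R]_4. Proof. by []. Qed.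

Lemma qvalM a b : qval (a * b)%g = qmul (qval a) (qval b). Proof. by []. Qed.

(** The product of a - 1 and x is 0, and the norm is multiplicative. *)
Lemma qmul_stab1 a x : x != 0 -> qmul (qval a) x = x -> a = 1%g.
Proof.
move=> x0 ax; apply: qval_inj; apply/eqP; rewrite -subr_eq0 -qnorm_eq0.
have : qnorm (qmul (qval a - qval 1%g) x) == 0.
  by rewrite qmulDl qmulNl ax qmul1q subrr qnorm_eq0.
by rewrite qnormM mulf_eq0 [qnorm x == 0]qnorm_eq0 (negbTE x0) orbF.
Qed.

Lemma qmul_stab1r a x : x != 0 -> qmul x (qval a^-1%g) = x -> a = 1%g.
Proof.
move=> x0 ax; apply: qval_inj; apply/eqP; rewrite -subr_eq0 -qnorm_eq0.
have {}ax : qmul x (qval a) = x by rewrite -[in LHS]ax -qmulA -qvalM mulVg qmulq1.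
have : qnorm (qmul x (qval a - qval 1%g)) == 0.
  by rewrite qmulDr qmulNr ax qmulq1 subrr qnorm_eq0.
by rewrite qnormM mulf_eq0 [qnorm x == 0]qnorm_eq0 (negbTE x0).
Qed.

Lemma qnormN1 : qnorm (- mkq 1 0 0 0 : 'rV[R]_4) = 1.
Proof. by rewrite -scaleN1r qnormZ normrN1 qnorm1 mul1r. Qed.

Definition Sp1_opp1 : Sp1 R := mkSp1 qnormN1.

Lemma Sp1_opp1_neq1 : Sp1_opp1 <> 1%g.
Proof.
move=> /(congr1 (fun a => q0 (qval a))); rewrite qval1 mkqE /= /q0 /mkq !mxE inordK //=.
by move=> /eqP; rewrite -subr_eq0 -opprD oppr_eq0 -[1 + 1]/(2%:R) pnatr_eq0.
Qed.

Lemma Sp1_opp1_conj x : qmul (qmul (qval Sp1_opp1) x) (qval Sp1_opp1^-1%g) = x.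
Proof.
have -> : (Sp1_opp1^-1)%g = Sp1_opp1.
  apply: (mulgI Sp1_opp1); rewrite mulgV; apply: qval_inj.
  by rewrite qvalM qmulNl qmulNr opprK qmulq1.
by rewrite /= qmulNl qmulNr qmulNl opprK qmul1q qmulq1.
Qed.

Lemma cisD s u : cis (s + u) = (cis s * cis u)%g.
Proof.
apply: qval_inj; rewrite qvalM /= /qmul !mkqE !mulrDr cosD sinD.
congr mkq; ring.
Qed.

Lemma cis_int (n : int) : cis n%:~R = 1%g :> Sp1 R.
Proof.
have cis1 : cis 1 = 1%g :> Sp1 R.
  by apply: qval_inj; rewrite /= mulr1 mulrC mulr_natr cos2pi sin2pi.
have cis_nat k : cis k%:R = 1%g :> Sp1 R.
  elim: k => [|k IH]; last by rewrite -addn1 natrD cisD IH cis1 mulg1.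
  by apply: qval_inj; rewrite /= mulr0 cos0 sin0.
case: n => k; first exact: cis_nat.
by rewrite NegzE rmorphN /= -[LHS]mulg1 -[X in (_ * X)%g](cis_nat k.+1) -cisD addNr (cis_nat 0).
Qed.

Lemma cis0 : cis 0 = 1%g :> Sp1 R.
Proof. exact: (cis_int 0). Qed.

Lemma cisN s : cis (- s) = (cis s)^-1%g.
Proof. by apply: (mulgI (cis s)); rewrite -cisD subrr mulgV cis0. Qed.

Lemma qmul_complexC s x : q2 x = 0 -> q3 x = 0 ->
  qmul x (qval (cis s)) = qmul (qval (cis s)) x.
Proof. by move=> x2 x3; rewrite /qmul !mkqE x2 x3; congr mkq; ring. Qed.

End UnitQuaternions.

(** * Actions along a tree *)

Section TreeFunctions.
Variables (d m c : nat) (t : quat_tree d m c).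

Lemma tree_ind (Q : option 'I_d -> Prop) :
  Q None -> (forall i, Q (parent t i) -> Q (Some i)) -> forall x, Q x.
Proof.
move=> Q0 QS [i|//]; have [n] := ubnP (depth t i); elim: n i => // n IH i din.
apply: QS; case E: (parent t i) => [j|//]; apply: IH.
by apply: leq_trans (depth_parent E) _; rewrite -ltnS.
Qed.

Lemma tree_rec_exists (T : Type) (a0 : T) (step : 'I_d -> T -> T) :
  exists a : 'I_d -> T, forall i, a i = step i (extend_root a0 a (parent t i)).
Proof.
(* The argument [n] is fuel: by [fE] the value no longer changes once [n] reaches the depth of [i],
   so the default [a0] on exhausted fuel does no harm. *)
pose f := fix f n i := step i (if parent t i is Some j then
  (if n is n'.+1 then f n' j else a0) else a0).
have fE n i : (depth t i <= n)%N -> f n i = f (depth t i) i.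
  have [k] := ubnP n; elim: k n i => // k IH n i nk din.
  case: n nk din => [|n] nk; first by rewrite leqn0 => /eqP ->.
  case D: (depth t i) => [|di] din /=; case E: (parent t i) => [j|//].
    by have := depth_parent E; rewrite D.
  have := depth_parent E; rewrite D ltnS => dj.
  by rewrite !(IH _ j) // ?(leq_trans dj) // (leq_trans din) // -ltnS.
exists (fun i => f (depth t i) i) => i; case D: (depth t i) => [|di] /=;
  case E: (parent t i) => [j|//] /=; have := depth_parent E; rewrite D ?ltn0 // ltnS => dj.
by rewrite fE.
Qed.

Definition slot n (e : 'I_n -> 'I_d) (x : option 'I_d) : option 'I_n :=
  if x is Some i then [pick j | e j == i] else None.

Definition spread (G : groupType) n (e : 'I_n -> 'I_d) (g : {ffun 'I_n -> G})
    (x : option 'I_d) : G := if slot e x is Some j then g j else 1%g.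

Lemma slot_mem n (e : 'I_n -> 'I_d) j : injective e -> slot e (Some (e j)) = Some j.
Proof.
move=> e_inj; rewrite /slot; case: pickP => [l /eqP/e_inj ->//|/(_ j)].
by rewrite eqxx.
Qed.

Lemma slot_notin n (e : 'I_n -> 'I_d) i : (forall j, e j <> i) -> slot e (Some i) = None.
Proof. by move=> ei; rewrite /slot; case: pickP => // j /eqP/ei. Qed.

Lemma slot_hnode_gnode j : slot (hnode t) (Some (gnode t j)) = None.
Proof. by apply: slot_notin => l /esym; apply: gnode_neq_hnode. Qed.

Lemma slot_gnode_hnode j : slot (gnode t) (Some (hnode t j)) = None.
Proof. by apply: slot_notin => l; apply: gnode_neq_hnode. Qed.

Lemma spread1 (G : groupType) n (e : 'I_n -> 'I_d) x :
  spread e (1%g : {ffun 'I_n -> G}) x = 1%g.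
Proof. by rewrite /spread; case: slot => // j; rewrite ffunE. Qed.

Lemma spreadM (G : groupType) n (e : 'I_n -> 'I_d) (g h : {ffun 'I_n -> G}) x :
  spread e (g * h)%g x = (spread e g x * spread e h x)%g.
Proof. by rewrite /spread; case: slot => [j|]; rewrite ?ffunE ?mulg1. Qed.

Section Values.
Variable G : groupType.
Implicit Types (g : {ffun 'I_m -> G}) (h : {ffun 'I_c -> G}) (a : 'I_d -> G).

(** At each node at least one of the two factors is 1, so they commute although [G] need not be
    abelian. *)
Lemma spread_gnode_hnodeC g h x :
  (spread (gnode t) g x * spread (hnode t) h x =
   spread (hnode t) h x * spread (gnode t) g x)%g.
Proof.
rewrite /spread; case: x => [i|]; last by rewrite !mulg1.
by case: (gnode_or_hnode t i) => -[j <-]; rewrite ?slot_hnode_gnode ?slot_gnode_hnode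
  (mulg1, mul1g) (mulg1, mul1g).
Qed.

Lemma spread_gnode_hnode a x :
  (spread (hnode t) [ffun j => a (hnode t j)] x *
   spread (gnode t) [ffun j => a (gnode t j)] x)%g = extend_root 1%g a x.
Proof.
rewrite /spread; case: x => [i|]; last by rewrite mulg1.
case: (gnode_or_hnode t i) => -[j <-]; rewrite ?slot_hnode_gnode ?slot_gnode_hnode
  slot_mem ?ffunE ?mulg1 ?mul1g //; [exact: gnode_inj | exact: hnode_inj].
Qed.

(** The two kinds of nodes partition the edges, so a pair of group elements amounts to one labelling
    of the nodes. *)
Lemma node_values g h : exists a,
  g = [ffun j => a (gnode t j)] /\ h = [ffun j => a (hnode t j)].
Proof.
exists (fun i => spread (gnode t) g (Some i) * spread (hnode t) h (Some i))%g.
split; apply/ffunP => j; rewrite ffunE /spread ?slot_hnode_gnode ?slot_gnode_hnode.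
  by rewrite slot_mem ?mulg1 //; apply: gnode_inj.
by rewrite slot_mem ?mul1g //; apply: hnode_inj.
Qed.

End Values.

(** At the root and at a [gnode] the exponent is 0, and [hnode_near] merely fills the index that a
    [coord_action] must supply. *)
Definition tree_action : coord_action d c := {|
  lidx i := odflt (hnode_near t i) (slot (hnode t) (left_end t i));
  lexp i := isSome (slot (hnode t) (left_end t i));
  ridx i := odflt (hnode_near t i) (slot (hnode t) (right_end t i));
  rexp i := isSome (slot (hnode t) (right_end t i)) |}.

Variable R : realType.
Implicit Types (g : Sp1pow R m) (h s : Sp1pow R c).

Lemma act_left_tree h i : act_left tree_action h i = spread (hnode t) h (left_end t i).
Proof. by rewrite ffunE /= /spread; case: slot => [j|]; rewrite /= ?expg1 ?expg0. Qed.

Lemma act_right_tree h i :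
  act_right tree_action h i = (spread (hnode t) h (right_end t i))^-1%g.
Proof. by rewrite ffunE /= /spread; case: slot => [j|]; rewrite /= ?expg1 ?expg0 ?invg1. Qed.

Definition gact_left g : Sp1pow R d := [ffun i => spread (gnode t) g (left_end t i)].
Definition gact_right g : Sp1pow R d := [ffun i => spread (gnode t) g (right_end t i)].

Lemma gact_left1 : gact_left 1%g = 1%g.
Proof. by apply/ffunP => i; rewrite !ffunE spread1. Qed.

Lemma gact_right1 : gact_right 1%g = 1%g.
Proof. by apply/ffunP => i; rewrite !ffunE spread1. Qed.

Lemma gact_leftM : {morph gact_left : g g' / (g * g')%g}.
Proof. by move=> g g'; apply/ffunP => i; rewrite !ffunE spreadM. Qed.

Lemma gact_rightM : {morph gact_right : g g' / (g * g')%g}.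
Proof. by move=> g g'; apply/ffunP => i; rewrite !ffunE spreadM. Qed.

HB.instance Definition _ := isMultiplicative.Build _ _ gact_left gact_leftM.
HB.instance Definition _ := isMultiplicative.Build _ _ gact_right gact_rightM.

Lemma spread_continuous x : continuous
  (fun g : {ptws 'I_m -> Sp1 R} => spread (gnode t) (finfun g : Sp1pow R m) x).
Proof.
rewrite /spread; case: slot => [j|]; last exact: cst_continuous.
suff -> : (fun g : {ptws 'I_m -> Sp1 R} => (finfun g : Sp1pow R m) j) = proj j.
  exact: proj_continuous.
by apply/funext => g; rewrite ffunE.
Qed.

Lemma gact_left_continuous : continuous_hom gact_left.
Proof.
move=> i; suff -> : (fun g : {ptws 'I_m -> Sp1 R} => gact_left (finfun g) i) =
    (fun g : {ptws 'I_m -> Sp1 R} => spread (gnode t) (finfun g : Sp1pow R m) (left_end t i)).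
  exact: spread_continuous.
by apply/funext => g; rewrite ffunE.
Qed.

Lemma gact_right_continuous : continuous_hom gact_right.
Proof.
move=> i; suff -> : (fun g : {ptws 'I_m -> Sp1 R} => gact_right (finfun g) i) =
    (fun g : {ptws 'I_m -> Sp1 R} => spread (gnode t) (finfun g : Sp1pow R m) (right_end t i)).
  exact: spread_continuous.
by apply/funext => g; rewrite ffunE.
Qed.

Definition edge_act (a : 'I_d -> Sp1 R) (q : 'M[R]_(d, 4)) : 'M[R]_(d, 4) :=
  coord_mul [ffun i => extend_root 1%g a (left_end t i)]
            [ffun i => (extend_root 1%g a (right_end t i))^-1%g] q.

Lemma edge_act_split a q :
  coord_mul (act_left tree_action [ffun j => a (hnode t j)])
            (act_right tree_action [ffun j => a (hnode t j)])
    (coord_mul (gact_left [ffun j => a (gnode t j)])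
               (gact_right [ffun j => a (gnode t j)])^-1%g q) = edge_act a q.
Proof.
rewrite coord_mulM; congr (coord_mul _ _ q); apply/ffunP => i.
  by rewrite [LHS]ffunE act_left_tree !ffunE spread_gnode_hnode.
rewrite [LHS]ffunE act_right_tree !ffunE -invgM.
by rewrite spread_gnode_hnode.
Qed.

(** Induct from the root: once the parent end of an edge carries 1, the label of its child end fixes
    a nonzero quaternion by multiplication from one side. *)
Lemma edge_act_free a q : (forall i, row i q != 0) -> edge_act a q = q ->
  forall i, a i = 1%g.
Proof.
move=> q0 aq i; apply: (tree_ind (Q := fun x => extend_root 1%g a x = 1%g) _ _ (Some i)) => // {}i ai.
have := congr1 (row i) aq; rewrite rowK !ffunE /left_end /right_end.
case: child_left; rewrite ai ?invg1 qval1 ?qmulq1 ?qmul1q.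
  exact: qmul_stab1.
exact: qmul_stab1r.
Qed.

Lemma edge_act_stabilizer q i0 : row i0 q = 0 ->
  exists a, edge_act a q = q /\ exists j, a (gnode t j) <> 1%g.
Proof.
(* [D] marks the nodes beyond the edge [i0], which get the label -1. Every edge other than [i0] has
   equal labels at both ends, and -1 is central. *)
move=> qi0; have [D DE] := tree_rec_exists false (fun i b => (i == i0) || b).
exists (fun i => if D i then Sp1_opp1 R else 1%g); split.
  apply/row_matrixP => i; rewrite rowK !ffunE.
  have [->|ii0] := eqVneq i i0.
    rewrite qi0; apply/eqP; rewrite -qnorm_eq0 !qnormM !qnorm_qval mul1r mulr1.
    by rewrite qnorm_eq0.
  have extE x : extend_root 1%g (fun j => if D j then Sp1_opp1 R else 1%g) x =
      if extend_root false D x then Sp1_opp1 R else 1%g by case: x.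
  rewrite !extE; have [-> ->] : extend_root false D (left_end t i) = D i /\
                 extend_root false D (right_end t i) = D i.
    by rewrite /left_end /right_end; case: child_left; rewrite /= DE (negbTE ii0).
  case: (D i); last by rewrite invg1 qval1 qmul1q qmulq1.
  exact: Sp1_opp1_conj.
have Di0 : D i0 by rewrite DE eqxx.
(* A deepest marked node is a [gnode], since an [hnode] would have a child, again marked and
   deeper. *)
case: (arg_maxnP (depth t) Di0) => i Di imax.
case: (gnode_or_hnode t i) => -[j ji].
  by exists j; rewrite ji Di; apply: Sp1_opp1_neq1.
have [l pl] := hnode_child t j; have := depth_parent pl; rewrite ji in pl *.
have Dl : D l by rewrite DE pl /= Di orbT.
by have := imax _ Dl; rewrite /geq /= leqNgt => /negP.
Qed.

End TreeFunctions.

(** * The torus kernel as coboundaries on the tree *)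

Section TorusKernel.
Variables (R : realType) (m d : nat) (v : 'M[int]_(d, m)).

(** Component j of theta v is the signed sum over the leg [None] minus that over the leg [Some j].
    So theta v is integral exactly when all differences of leg sums are, and those against [k0] are
    the values at the tips. *)
Lemma facet_tree_integral (kap : 'I_d -> option 'I_m) (eps : 'I_d -> bool) k0
    (t : quat_tree d m (d - m)) (e : 'I_m -> option 'I_m) :
  (forall i, row i v = (-1) ^+ eps i *: simplex_normal (kap i)) ->
  (forall j, e j != k0) -> (forall k, k != k0 -> exists j, e j = k) ->
  (forall (V : zmodType) (al : 'I_d -> V) j,
    \sum_(i | kap i == e j) (if eps i then - edge_diff t al i else edge_diff t al i) -
    \sum_(i | kap i == k0) (if eps i then - edge_diff t al i else edge_diff t al i)
    = al (gnode t j)) ->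
  forall al : 'I_d -> R,
    (exists z : 'rV[int]_m,
      (\row_i edge_diff t al i) *m map_mx intr v = map_mx intr z) <->
    (forall j, exists n : int, al (gnode t j) = n%:~R).
Proof.
move=> vE eK e_onto legE al.
pose leg k := \sum_(i | kap i == k)
  (if eps i then - edge_diff t al i else edge_diff t al i).
have mulE j : ((\row_i edge_diff t al i) *m map_mx intr v) 0 j =
    leg None - leg (Some j).
  rewrite mxE /leg [X in X - _]big_mkcond [X in _ - X]big_mkcond -sumrB.
  apply: eq_bigr => i _; have -> : (map_mx intr v) i j = (row i v 0 j)%:~R :> R.
    by rewrite !mxE.
  rewrite mxE vE; case: (kap i) => [l|].
    rewrite !mxE !eqxx /= sub0r -[Some l == Some j]/(l == j) eq_sym.
    case: (eps i); case: (l == j);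
      rewrite ?expr1 ?expr0 ?mulN1r ?mul1r ?opprK ?oppr0 ?mulr0 ?mulr1 ?mulrN1z ?mulrN1 //.
  by rewrite !mxE /= subr0; case: (eps i); rewrite ?expr1 ?expr0 ?mulr1 ?mulrN1z ?mulrN1.
split=> [[z ze] j|alZ].
  pose f k := if k is Some l then - (z 0 l) else 0%Z.
  have legf k : leg k - leg None = (f k)%:~R.
    case: k => [l|]; last by rewrite subrr.
    by rewrite -opprB -mulE ze mxE rmorphN.
  exists (f (e j) - f k0); rewrite -legE -[LHS]/(leg (e j) - leg k0).
  by rewrite rmorphB /= -!legf opprB addrA subrK.
have legZ k : exists n : int, leg k - leg k0 = n%:~R.
  have [->|/e_onto[j <-]] := eqVneq k k0; first by exists 0; rewrite subrr.
  by have [n nE] := alZ j; exists n; rewrite -nE -legE.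
have /choice[f fE] := legZ.
exists (\row_j (f None - f (Some j))); apply/rowP => j.
by rewrite mulE !mxE rmorphB /= -!fE opprB addrA subrK.
Qed.

Variable t : quat_tree d m (d - m).
Hypothesis integral : forall al : 'I_d -> R,
  (exists z : 'rV[int]_m,
    (\row_i edge_diff t al i) *m map_mx intr v = map_mx intr z) <->
  (forall j, exists n : int, al (gnode t j) = n%:~R).

(** Circle elements commute with complex coordinates, so the right factor can be moved to the
    left. *)
Let phi (s : Sp1pow R (d - m)) : Sp1pow R d :=
  [ffun i => spread (hnode t) s (left_end t i) *
             (spread (hnode t) s (right_end t i))^-1]%g.

(** Integral values at the [gnode]s exponentiate to 1, which is what [spread] puts there. *)
Let spread_cis (al : 'I_d -> R) x : (forall j, exists n : int, al (gnode t j) = n%:~R) ->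
  spread (hnode t) [ffun j => cis (al (hnode t j))] x = cis (extend_root 0 al x).
Proof.
move=> alZ; rewrite /spread; case: x => [i|]; last by rewrite cis0.
case: (gnode_or_hnode t i) => -[j <-].
  by rewrite slot_hnode_gnode /=; have [n ->] := alZ j; rewrite cis_int.
by rewrite slot_mem ?ffunE //; apply: hnode_inj.
Qed.

Let torus_angles (s : Sp1pow R (d - m)) : torus s -> exists al : 'I_d -> R,
  (forall j, al (gnode t j) = 0) /\ s = [ffun j => cis (al (hnode t j))].
Proof.
move=> sT; have /choice[f fP] : forall j, exists r, cis r = s j.
  by move=> j; have [r _ <-] := sT j; exists r.
exists (fun i => if slot (hnode t) (Some i) is Some j then f j else 0); split => [j|].
  by rewrite slot_hnode_gnode.
apply/ffunP => j; rewrite ffunE slot_mem; last exact: hnode_inj.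
by rewrite fP.
Qed.

Let phi_cis (al : 'I_d -> R) : (forall j, exists n : int, al (gnode t j) = n%:~R) ->
  phi [ffun j => cis (al (hnode t j))] = [ffun i => cis (edge_diff t al i)].
Proof.
by move=> alZ; apply/ffunP => i; rewrite !ffunE !spread_cis // -cisN -cisD.
Qed.

Let spread_torus (s : Sp1pow R (d - m)) x : torus s -> exists r, spread (hnode t) s x = cis r.
Proof.
move=> /torus_angles[al [al0 ->]]; exists (extend_root 0 al x).
by apply: spread_cis => j; exists 0; rewrite al0.
Qed.

Lemma tree_extends_torus_kernel : extends_torus_kernel R v (tree_action t).
Proof.
exists phi; split.
- split.
  + move=> s /torus_angles[al [al0 ->]].
    have alZ j : exists n : int, al (gnode t j) = n%:~R by exists 0; rewrite al0.
    rewrite phi_cis //; exists (\row_i edge_diff t al i); split=> [i|].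
      by rewrite ffunE mxE.
    exact/integral.
  (* Injectivity: the quotients along the edges determine the labels successively from the root. *)
  + move=> s s' _ _ /ffunP phiE.
    suff E x : spread (hnode t) s x = spread (hnode t) s' x.
      apply/ffunP => j; have := E (Some (hnode t j)).
      by rewrite /spread slot_mem //; apply: hnode_inj.
    elim/(tree_ind (t := t)): x => // i pE.
    have := phiE i; rewrite !ffunE /left_end /right_end.
    by case: child_left; rewrite pE; [move/mulIg | move/mulgI/invg_inj].
  + move=> u [theta [uE uZ]].
    (* Surjectivity: integrate [theta] along the tree, starting from 0 at the root. *)
    have [al alE] := tree_rec_exists t 0 (fun i r =>
      if child_left t i then theta 0 i + r else r - theta 0 i).
    have dE : \row_i edge_diff t al i = theta.
      apply/rowP => i; rewrite mxE /edge_diff /left_end /right_end.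
      have := alE i; case: child_left => E; rewrite [extend_root _ _ (Some i)]E.
        by rewrite addrK.
      by rewrite opprB addrCA subrr addr0.
    have alZ : forall j, exists n : int, al (gnode t j) = n%:~R.
      by apply/integral; rewrite dE.
    exists [ffun j => cis (al (hnode t j))].
      by move=> j; rewrite ffunE; exists (al (hnode t j)).
    rewrite phi_cis //; apply/ffunP => i; rewrite ffunE uE -dE mxE //.
- move=> s s' sT s'T; apply/ffunP => i; rewrite !ffunE !spreadM invgM.
  have [r1 ->] := spread_torus (left_end t i) sT.
  have [r2 ->] := spread_torus (left_end t i) s'T.
  have [r3 ->] := spread_torus (right_end t i) sT.
  have [r4 ->] := spread_torus (right_end t i) s'T.
  by rewrite -!cisN -!cisD; congr cis; ring.
- move=> s z sT zC; apply/row_matrixP => i; rewrite !rowK.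
  rewrite act_left_tree act_right_tree !ffunE [X in _ = qmul _ X]qval1 qmulq1.
  have [r ->] := spread_torus (left_end t i) sT.
  have [r' ->] := spread_torus (right_end t i) sT.
  have [z2 z3] := zC i.
  by rewrite -cisN -qmulA qmul_complexC // qmulA.
Qed.

End TorusKernel.

(** * The orbit space *)

Section NonzeroCoordinates.
Variables (R : realType) (m d : nat) (v : 'M[int]_(d, m)) (lam : 'I_d -> R).
Implicit Types q p : 'M[R]_(d, 4).

Definition nonzero_coords : set 'M[R]_(d, 4) := [set q | forall i, row i q != 0].

Definition root4 (r : R) : R := Num.sqrt (Num.sqrt r).

Lemma root4K r : 0 <= r -> root4 r ^+ 4 = r.
Proof. by move=> r0; rewrite (exprM _ 2 2) !sqr_sqrtr ?sqrtr_ge0. Qed.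

Lemma exp4K r : 0 <= r -> root4 (r ^+ 4) = r.
Proof.
by move=> r0; rewrite (exprM _ 2 2) /root4 !sqrtr_sqr ger0_norm ?sqr_ge0 // sqrtr_sqr ger0_norm.
Qed.

Lemma root4_continuous : continuous root4.
Proof.
by move=> r; apply: continuous_comp; apply: sqrt_continuous.
Qed.

Lemma qnorm_root4Z r (u : 'rV[R]_4) :
  0 <= r -> qnorm u = 1 -> qnorm (root4 r *: u) ^+ 4 = r.
Proof. by move=> r0 u1; rewrite qnormZ u1 mulr1 ger0_norm ?sqrtr_ge0 // root4K. Qed.

(** Choose |q_i|^4 so that sigma_i(q) is the pairing of x with the i-th normal; then sigma(q)
    vanishes on the kernel of y |-> y v. *)
Lemma Zset_nonzero (x : 'rV[R]_m) :
  (forall i, pairing x (real_row R (row i v)) < lam i) ->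
  exists2 q, Zset v lam q & nonzero_coords q.
Proof.
move=> x_in.
pose r i := 4 * (lam i - pairing x (real_row R (row i v))).
have r_gt0 i : 0 < r i by rewrite mulr_gt0 // subr_gt0.
have qE i : row i (\matrix_j (root4 (r j) *: mkq 1 0 0 0)) = root4 (r i) *: mkq 1 0 0 0.
  exact: rowK.
exists (\matrix_i (root4 (r i) *: mkq 1 0 0 0)) => [y yv|i]; last first.
  by rewrite qE -qnorm_exp4_gt0 qnorm_root4Z ?qnorm1 ?r_gt0 ?(ltW (r_gt0 i)).
under eq_bigr => i _.
  rewrite /sigma qE qnorm_root4Z ?qnorm1 ?(ltW (r_gt0 i)) //.
  have -> : - 4^-1 * r i + lam i = pairing x (real_row R (row i v)) by rewrite /r; field.
  rewrite mulr_suml; over.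
rewrite exchange_big big1 // => j _.
have /rowP/(_ j) := yv; rewrite !mxE => yj.
under eq_bigr do rewrite -mulrA.
rewrite -mulr_sumr (eq_bigr (fun i => y 0 i * (map_mx intr v : 'M[R]_(d, m)) i j)) ?yj ?mulr0 //.
by move=> i _; rewrite !mxE mulrC.
Qed.

(** Keep the directions of the coordinates of [q] and interpolate the fourth powers of the norms
    from [q] to [p]. The equations of [Zset] are affine in these powers, which are positive for 0 <
    s <= 1, and s -> 0 leads back to [q]. *)
Lemma Zset_nonzero_dense p q (U : set 'M[R]_(d, 4)) :
  Zset v lam p -> nonzero_coords p -> Zset v lam q -> nbhs q U ->
  exists q', [/\ Zset v lam q', nonzero_coords q' & U q'].
Proof.
move=> Zp p0 Zq qU.
have /choice[u uP] : forall i, exists u, qnorm u = 1 /\ row i q = qnorm (row i q) *: u.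
  by move=> i; apply: quat_direction.
pose w (s : R) i := (1 - s) * qnorm (row i q) ^+ 4 + s * qnorm (row i p) ^+ 4.
pose f (s : R) := \matrix_i (root4 (w s i) *: u i).
have w_gt0 s i : 0 < s <= 1 -> 0 < w s i.
  move=> /andP[s0 s1]; apply: ltr_wpDl.
    by rewrite mulr_ge0 ?subr_ge0 // exprn_ge0 ?qnorm_ge0.
  by rewrite mulr_gt0 // qnorm_exp4_gt0.
have fE s i : 0 < s <= 1 -> qnorm (row i (f s)) ^+ 4 = w s i.
  by move=> /w_gt0 ws; rewrite rowK qnorm_root4Z ?ltW //; case: (uP i).
have fcvg : f s @[s --> 0^'+] --> q.
  apply/cvg_ballP => e e0.
  suff : \forall s \near 0^'+, forall i j, ball (q i j) e (f s i j).
    by apply: filterS => s H; split.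
  apply: filter_forall => i; apply: filter_forall => j.
  have -> : q i j = root4 (w 0 i) * u i 0 j.
    rewrite /w subr0 mul1r mul0r addr0 exp4K ?qnorm_ge0 //.
    by have [_ /rowP/(_ j)] := uP i; rewrite !mxE.
  have fij s : f s i j = root4 (w s i) * u i 0 j by rewrite !mxE.
  have : (fun s => root4 (w s i) * u i 0 j) s @[s --> 0^'+] --> root4 (w 0 i) * u i 0 j.
    apply: cvgMl; apply: cvg_at_right_filter.
    apply: (@continuous_comp _ _ _ (w^~ i) root4); last exact: root4_continuous.
    apply: cvgD; apply: cvgMl; last exact: cvg_id.
    by apply: cvgB; [exact: cvg_cst | exact: cvg_id].
  by move=> /cvg_ballP/(_ _ e0); apply: filterS => s; rewrite fij.
have : \forall s \near 0^'+, U (f s) by apply: fcvg.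
move=> Uf; near (0 : R)^'+ => s.
have s01 : 0 < s <= 1 by apply/andP; split; near: s; [exact: nbhs_right_gt | exact: nbhs_right_le].
exists (f s); split; last by near: s.
- move=> y yv; have := Zp y yv; have := Zq y yv; move=> Zqy Zpy.
  transitivity ((1 - s) * (\sum_i sigma lam q i * y 0 i) + s * (\sum_i sigma lam p i * y 0 i)).
    rewrite !mulr_sumr -big_split; apply: eq_bigr => i _ /=.
    by rewrite /sigma fE // /w; ring.
  by rewrite Zqy Zpy !mulr0 addr0.
- by move=> i; rewrite -qnorm_exp4_gt0 fE ?w_gt0.
Unshelve. all: by end_near. Qed.

Lemma nonzero_coords_open : open nonzero_coords.
Proof.
rewrite openE => q q0.
suff row_near i : \forall p \near q, row i p != 0.
  exact: (@filter_forall _ _ (fun i p => row i p != 0) (nbhs q) _ row_near).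
have [j qj] : exists j, q i j != 0.
  apply: contrapT => H; move: (q0 i) => /eqP; apply; apply/rowP => j; rewrite !mxE.
  by apply/eqP/negP => /negP qj; apply: H; exists j.
have : \forall p \near q, (p : 'M[R]_(d, 4)) i j != 0.
  have /cvgr_neq0 := @coord_continuous R d 4 i j q; exact.
apply: filterS => p; apply: contra => /eqP/rowP/(_ j); rewrite !mxE => ->.
exact: eqxx.
Qed.

End NonzeroCoordinates.

Section OrbitSpaceAction.
Variables (R : realType) (m d : nat) (v : 'M[int]_(d, m)) (lam : 'I_d -> R).
Variable t : quat_tree d m (d - m).
Let A := tree_action t.
Let X := orbit_space v lam A.
Implicit Types (g : Sp1pow R m) (q : Zset v lam) (x : X).

Lemma orbit_piP (p q : Zset v lam) :
  \pi_X p = \pi_X q <-> exists h, hat_act A h p = q.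
Proof.
have : reflect (\pi_X p = \pi_X q) (orbit_equiv v lam A p q) by exact: eqmodP.
by move=> /rwP pq; split=> [/pq/asboolP|/asboolP/pq].
Qed.

Lemma orbit_pi_surj x : exists q, \pi_X q = x.
Proof. by exists (repr x); rewrite reprK. Qed.

Definition orbit_act g x : X := \pi_X (Zmul (gact_left t g) (gact_right t g)^-1%g (repr x)).

(** The actions of the two groups commute, so the choice of representative does not matter. *)
Lemma orbit_act_pi g q :
  orbit_act g (\pi_X q) = \pi_X (Zmul (gact_left t g) (gact_right t g)^-1%g q).
Proof.
have /orbit_piP[h] : \pi_X q = \pi_X (repr (\pi_X q)) by rewrite reprK.
rewrite /orbit_act => <-; symmetry; apply/orbit_piP; exists h.
rewrite /hat_act !ZmulM; congr (Zmul _ _ q); apply/ffunP => i.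
  rewrite [LHS]ffunE [RHS]ffunE act_left_tree [gact_left t g i]ffunE.
  by rewrite spread_gnode_hnodeC.
rewrite [LHS]ffunE [RHS]ffunE act_right_tree [(gact_right t g)^-1%g i]ffunE.
by rewrite [gact_right t g i]ffunE -!invgM spread_gnode_hnodeC.
Qed.

Lemma orbit_act_is_left_action : is_left_action orbit_act.
Proof.
split=> [x|g h x]; have [q <-] := orbit_pi_surj x; rewrite !orbit_act_pi.
  by rewrite gact_left1 gact_right1 invg1 Zmul1.
by rewrite ZmulM gact_leftM gact_rightM invgM.
Qed.

(** The class of [q] is fixed by [g] when some [h] brings g q back to q, and the pair of [g] and [h]
    is a labelling [a]. *)
Lemma orbit_act_fixP g q :
  orbit_act g (\pi_X q) = \pi_X q <->
  exists2 a, edge_act t a (val q) = val q & g = [ffun j => a (gnode t j)].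
Proof.
rewrite orbit_act_pi; split=> [/orbit_piP[h /(congr1 val) hq]|[a aq ->]].
  have [a [gE hE]] := node_values t g h; exists a => //.
  by rewrite -edge_act_split -gE -hE.
apply/orbit_piP; exists [ffun j => a (hnode t j)].
by apply: val_inj; rewrite -[RHS]aq -edge_act_split.
Qed.

Lemma isotropy_trivial q :
  isotropy orbit_act (\pi_X q) = [set 1%g] <-> nonzero_coords (val q).
Proof.
split=> [iso i|q0].
  apply/eqP => qi; have [a [aq [j aj]]] := edge_act_stabilizer t qi.
  have : isotropy orbit_act (\pi_X q) [ffun j => a (gnode t j)].
    by apply/orbit_act_fixP; exists a.
  by rewrite iso => /= /ffunP/(_ j); rewrite !ffunE.
apply/seteqP; split => g /=.
  move=> /orbit_act_fixP[a aq ->]; apply/ffunP => j; rewrite !ffunE.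
  exact: edge_act_free aq _.
by move=> ->; have [act1 _] := orbit_act_is_left_action; apply: act1.
Qed.

Lemma conj_set1 (G : groupType) (g : G) : conj_set [set 1%g] g = [set 1%g].
Proof. by rewrite /conj_set image_set1 conj1g. Qed.

Hypothesis Z_nonzero : exists2 q, Zset v lam q & nonzero_coords q.

Lemma orbit_act_principal : principal_isotropy orbit_act [set 1%g].
Proof.
have [p Zp p0] := Z_nonzero.
have principalE : [set x | exists g, isotropy orbit_act x = conj_set [set 1%g] g] =
    [set x | isotropy orbit_act x = [set 1%g]].
  by apply/seteqP; split=> x /= => [[g]|]; rewrite ?conj_set1 //; exists 1%g; rewrite conj_set1.
split.
- by exists (\pi_X (exist _ p (mem_set Zp))); apply/isotropy_trivial.
- move=> x; exists 1%g; rewrite conj_set1 => _ ->.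
  by have [e _] := orbit_act_is_left_action; apply: e.
- rewrite principalE; exists (@nonzero_coords R d); first exact: nonzero_coords_open.
  by apply/seteqP; split=> q /=; rewrite isotropy_trivial.
(* An open set of orbits pulls back to the trace on [Zset] of an open [U], where density upstairs
   applies. *)
- rewrite principalE => O [x Ox] [U Uopen UE]; have [q qx] := orbit_pi_surj x.
  have Uq : U (val q).
    have : ((set_val : Zset v lam -> _) @^-1` U) q by rewrite UE /= qx.
    by [].
  have Zq : Zset v lam (val q) by apply: set_mem; apply: valP.
  have [q' [Zq' q'0 Uq']] := Zset_nonzero_dense Zp p0 Zq (open_nbhs_nbhs (conj Uopen Uq)).
  pose z : Zset v lam := exist _ q' (mem_set Zq').
  exists (\pi_X z); split; last by apply/isotropy_trivial.
  have : ((set_val : Zset v lam -> _) @^-1` U) z by [].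
  by rewrite UE.
Qed.

Lemma orbit_act_effective : effective orbit_act.
Proof.
have [[x xiso] _ _ _] := orbit_act_principal.
by move=> g gx; have : isotropy orbit_act x g by []; rewrite xiso.
Qed.

End OrbitSpaceAction.

Theorem proposition4p7 (R : realType) (m d : nat)
    (v : 'M[int]_(d, m)) (lam : 'I_d -> R)
    (hP : delzant_polytope v lam)
    (hcut : cut_from_simplex (polyhedron v lam)) :
  exists2 A : coord_action d (d - m), extends_torus_kernel R v A &
  exists (l r : {multiplicative Sp1pow R m -> Sp1pow R d})
         (to : Sp1pow R m -> orbit_space v lam A -> orbit_space v lam A),
    [/\ continuous_hom l /\ continuous_hom r,
        is_left_action to,
        forall g (q : Zset v lam),
          to g (\pi_(orbit_space v lam A) q) =
          \pi_(orbit_space v lam A) (Zmul (l g) (r g)^-1%g q),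
        effective to &
        principal_isotropy to [set 1%g]].
Proof.
have /choice[kap /choice[eps vE]] := facet_normal_simplex hP hcut.
have kap_eps_inj i j : kap i = kap j -> eps i = eps j -> i = j.
  by move=> k e; apply: (facet_row_inj hP); rewrite /= !vE k e.
have [k0 k0P] : exists k0, (forall k, exists i, kap i = k) \/
    (forall k s, k != k0 -> exists i, kap i = k /\ eps i = s).
  (* Take a missing direction if there is one; otherwise any choice works, and [None] is taken. *)
  have [[k0 k0N]|all] := pselect (exists k0, forall i, kap i != k0).
    by exists k0; right => k s; exact: (facet_both_signs hP s vE k0N).
  exists None; left => k; apply: contrapT => kN; apply: all; exists k => i.
  by apply/eqP => ki; apply: kN; exists i.
have m_gt0 : 'I_d -> (0 < m)%N by move=> i; have [k _ <-] := facet_of_affdim hP i.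
have [t [e [eK e_onto legE]]] := facet_tree_exists kap_eps_inj k0P m_gt0.
have [x x_in] := polyhedron_interior_point hP.
have Z_nonzero := Zset_nonzero x_in.
exists (tree_action t).
  exact/tree_extends_torus_kernel/(facet_tree_integral vE eK e_onto legE).
exists (@gact_left _ _ _ t R), (@gact_right _ _ _ t R), (@orbit_act _ _ _ v lam t); split.
- by split; [exact: gact_left_continuous | exact: gact_right_continuous].
- exact: orbit_act_is_left_action.
- exact: orbit_act_pi.
- exact: orbit_act_effective.
- exact: orbit_act_principal.
Qed.
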